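(* Let $h_1,h_2,h_3\in\mathbb R$ with $h_1^2\geq h_2^2\geq h_3^2$ and $P>0$. The sum-capacity $C_N$ of the (non-restricted) Gaussian Y-channel with gains $h_1,h_2,h_3$ and power $P$ satisfies $C_N\geq\underline{C}_1$, where $$\underline{C}_1=\min\Big\{\tfrac12\big[C(\min\{h_1^2,h_2^2+h_3^2\}P)+C(h_2^2P)+C(h_3^2P)\big],\ C((h_1^2+h_2^2+h_3^2)P),\ 2C(h_3^2P)\Big\}.$$
   Context: $C(x)=\frac12\log_2(1+x)$. The (non-restricted, reciprocal) Gaussian Y-channel with real gains $h_1,h_2,h_3$ and power $P>0$: users $1,2,3$ and a relay $r$. For each ordered pair $(j,k)$ of distinct indices in $\{1,2,3\}$, user $j$ holds a message $m_{jk}$, uniform on $\{1,\dots,2^{nR_{jk}}\}$, intended for user $k$; the six messages are mutually independent. Over channel uses $i=1,\dots,n$, the relay receives $Y_{ri}=h_1X_{1i}+h_2X_{2i}+h_3X_{3i}+Z_{ri}$ and user $j$ receives $Y_{ji}=h_jX_{ri}+Z_{ji}$, all noise samples i.i.d. $\mathcal N(0,1)$ independent of the messages. Encoders $X_{ji}=f_{ji}(m_{jk},m_{jl},Y_j^{i-1})$ ($\{k,l\}=\{1,2,3\}\setminus\{j\}$), relay $X_{ri}=f_{ri}(Y_r^{i-1})$, power constraints $\frac1n\sum_i\mathbb E[X_{ai}^2]\le P$ for $a\in\{1,2,3,r\}$; user $j$ estimates $(m_{kj},m_{lj})$ from $(Y_j^n,m_{jk},m_{jl})$. A rate tuple is achievable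 if codes exist whose error probability tends to $0$ as $n\to\infty$; $C_N$ is the supremum of $\sum_{j\ne k}R_{jk}$ over achievable tuples. *)

(* Defs.v *)
From HB Require Import structures.
From mathcomp Require Import all_boot all_order all_algebra.
From mathcomp Require Import all_classical all_reals all_analysis.
From mathcomp Require Import normal_distribution.

Set Implicit Arguments.
Unset Strict Implicit.
Unset Printing Implicit Defensive.

Import Order.TTheory GRing.Theory Num.Theory.
Import numFieldNormedType.Exports.

Local Open Scope classical_set_scope.
Local Open Scope ring_scope.

Section YChannel.
Context {R : realType}.

Definition Ccap (x : R) : R := ln (1 + x) / (2 * ln 2).

Definition u1 : 'I_3 := inord 0.
Definition u2 : 'I_3 := inord 1.
Definition u3 : 'I_3 := inord 2.

Definition msz (n : nat) (r : R) : nat := `| Num.ceil (2 `^ (n%:R * r)) |%N.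

(* message-set size for the ordered pair p = (j,k); diagonal pairs carry a
   trivial (one-element) message *)
Definition Msz (n : nat) (rt : 'I_3 -> 'I_3 -> R) (p : 'I_3 * 'I_3) : nat :=
  if p.1 == p.2 then 1%N else msz n (rt p.1 p.2).

Definition msgs (M : 'I_3 * 'I_3 -> nat) : finType :=
  {dffun forall p : 'I_3 * 'I_3, 'I_(M p)}.

(* A code of block length n with message-set sizes M.
   enc j i : user j's encoder at time i (times are 0,...,n-1): it sees its own
             outgoing messages (m_{jk})_k and its past received outputs
             Y_j(0..i-1) as an i-tuple;
   rel i   : relay function at time i, of the past relay outputs Y_r(0..i-1);
   dec j   : decoder of user j: from its own messages and Y_j(0..n-1) it
             produces estimates of the incoming messages (m_{kj})_k. *)
Record code (n : nat) (M : 'I_3 * 'I_3 -> nat) := Code {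
  enc : forall (j : 'I_3) (i : nat), (forall k : 'I_3, 'I_(M (j, k))) ->
          i.-tuple R -> R;
  rel : forall i : nat, i.-tuple R -> R;
  dec : forall j : 'I_3, (forall k : 'I_3, 'I_(M (j, k))) ->
          n.-tuple R -> (forall k : 'I_3, 'I_(M (k, j))) }.
Arguments enc {n M} c j i _ _.
Arguments rel {n M} c i _.
Arguments dec {n M} c j _ _ _.

Definition code_measurable n M (c : code n M) : Prop :=
  [/\ (forall j i mj, measurable_fun [set: i.-tuple R] (enc c j i mj)),
      (forall i, measurable_fun [set: i.-tuple R] (rel c i)) &
      (forall j mj v, measurable [set y : n.-tuple R | dec c j mj y = v])].

Definition tup (i : nat) (y : nat -> R) : i.-tuple R :=
  mktuple (fun k : 'I_i => y (nat_of_ord k)).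

Section Run.
Variables (n : nat) (M : 'I_3 * 'I_3 -> nat) (c : code n M) (h : 'I_3 -> R)
  (w : msgs M) (z : nat -> R).
(* noise: z (4 t + j) is the noise Z_{j} at time t at user j (j < 3),
   z (4 t + 3) is the relay noise Z_r at time t. *)

(* hist i a t = received signal of node a (Some j = user j, None = relay)
   at time t, for t < i (and 0 for t >= i) *)
Fixpoint hist (i : nat) : option 'I_3 -> nat -> R :=
  match i with
  | 0%N => fun _ _ => 0
  | i'.+1 =>
    let H := hist i' in
    let xr := rel c i' (tup i' (H None)) in
    let xu := fun j : 'I_3 => enc c j i' (fun k => w (j, k)) (tup i' (H (Some j))) in
    fun a t =>
      if (t < i')%N then H a t
      else if t == i' then
        match a with
        | None => \sum_(j < 3) h j * xu j + z (4 * i' + 3)%N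
        | Some j => h j * xr + z (4 * i' + j)%N
        end
      else 0
  end.

Definition xuser (j : 'I_3) (t : nat) : R :=
  enc c j t (fun k => w (j, k)) (tup t (hist t (Some j))).
Definition xrelay (t : nat) : R := rel c t (tup t (hist t None)).

Definition err : bool :=
  [exists j : 'I_3, [exists k : 'I_3, (k != j) &&
     (dec c j (fun k => w (j, k)) (tup n (hist n (Some j))) k != w (k, j))]].
End Run.

Local Open Scope ereal_scope.

(* Gexp k F = E[F(Z)] where Z_0, ..., Z_{k-1} are i.i.d. N(0,1) and Z_t = 0 for
   t >= k (iterated integral against the standard normal law) *)
Fixpoint Gexp (k : nat) (F : (nat -> R) -> \bar R) : \bar R :=
  match k with
  | 0%N => F (fun _ => 0%R)
  | k'.+1 => \int[normal_prob 0%R 1%R]_x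
               Gexp k' (fun s => F (fun t => if t == 0%N then x else s t.-1))
  end.

Definition Eavg n M (F : msgs M -> (nat -> R) -> \bar R) : \bar R :=
  ((#|msgs M|%:R)^-1)%:E * \sum_(w : msgs M) Gexp (4 * n) (F w).

Definition err_prob n M (c : code n M) (h : 'I_3 -> R) : \bar R :=
  Eavg n (fun w z => ((err c h w z)%:R)%:E).

Definition power_ok n M (c : code n M) (h : 'I_3 -> R) (P : R) : Prop :=
  (forall j : 'I_3,
     \sum_(t < n) Eavg n (fun w z => ((xuser c h w z j t) ^+ 2)%:E) <= (n%:R * P)%:E)
  /\ \sum_(t < n) Eavg n (fun w z => ((xrelay c h w z t) ^+ 2)%:E) <= (n%:R * P)%:E.

Definition achievable (h : 'I_3 -> R) (P : R) (rt : 'I_3 -> 'I_3 -> R) : Prop :=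
  (forall j k : 'I_3, j != k -> (0 <= rt j k)%R) /\
  exists c : forall n : nat, code n (Msz n rt),
    (forall n, code_measurable (c n)) /\
    (forall n, power_ok (c n) h P) /\
    ((fun n => err_prob (c n) h) @ \oo --> 0).

Definition sum_capacity (h : 'I_3 -> R) (P : R) : \bar R :=
  ereal_sup [set (\sum_(j < 3) \sum_(k < 3 | k != j) rt j k)%R%:E
            | rt in achievable h P].

Local Close Scope ereal_scope.

Definition Clow1 (h : 'I_3 -> R) (P : R) : R :=
  let a := h u1 ^+ 2 in let b := h u2 ^+ 2 in let d := h u3 ^+ 2 in
  Num.min (Num.min ((Ccap (Num.min a (b + d) * P) + Ccap (b * P) + Ccap (d * P)) / 2)
                   (Ccap ((a + b + d) * P)))
          (2 * Ccap (d * P)).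

End YChannel.

(* Main.v *)
(* Complete decode-forward.  Only the messages 1 -> 2, 2 -> 3 and 3 -> 1 get a
   positive rate.  Transmission is block Markov: in each block the users send
   sub-messages over the Gaussian multiple access channel, the relay decodes the
   whole triple and broadcasts it in the next block, and each user decodes it
   with its own sub-message as side information.

   All codewords, of the users and of the relay, come from one Gaussian
   codebook, and all nodes use threshold decoding on the Gaussian information
   density.  Chernoff's bound replaces the indicator of every error event by the
   exponential of a quadratic form in the noise and the codebook.  Its mean
   factorizes over the channel uses, and each factor is an explicit Gaussian
   integral; a good codebook is then fixed letter by letter.  For a set A of
   wrong indices, the competitors contribute about exp (n (sum_A R - C)), where C
   is the capacity seen by the decoding node, so that all rates with
   R1 + R2 + R3 < C((h1^2+h2^2+h3^2) P), R2 + R3 < C(min(h1^2, h2^2+h3^2) P),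
   R1 + R3 < C(h2^2 P), R1 + R2 < C(h3^2 P) and R3 < C(h3^2 P) are achievable;
   their largest sum is the bound. *)

(* Expectations here are iterated integrals of functions whose joint measurability is never
   examined. Hence the error indicator is dominated pointwise by a finite sum of exponentials of
   quadratics, whose iterated integral has a closed form; elsewhere monotonicity and superadditivity
   suffice, and both hold for any nonnegative functions. Competitors are treated with Chernoff
   parameter one: this is a change of measure, so the codebook mean per letter is exactly V^(-1/2)
   up to the threshold slack, V being the output variance, which is the capacity exponent in nats.
   If exactly the indices in A are wrong, the other codewords cancel and the true and wrong signals
   use disjoint letters, hence are independent. The cyclic pattern gives each user one known index,
   so it resolves only two: the three pair constraints add up to the half-sum, while R1 + R2 and R3,
   each below C(h3^2 P), give 2C(h3^2 P). The number of blocks stays fixed while the block length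
   grows. Codewords of excessive power are replaced by zero, so the power constraint holds surely
   and the replacement counts as an error event. *)
Require Import Defs.
From HB Require Import structures.
From mathcomp Require Import all_boot all_order all_algebra.
From mathcomp Require Import all_classical all_reals all_analysis.
From mathcomp Require Import measurable_realfun normal_distribution.
From mathcomp Require Import ring lra zify.

Set Implicit Arguments.
Unset Strict Implicit.
Unset Printing Implicit Defensive.

Import Order.TTheory GRing.Theory Num.Theory.
Import numFieldNormedType.Exports.
Import HBNNSimple.

Local Open Scope classical_set_scope.
Local Open Scope ring_scope.

(** * Gaussian integrals *)

Section GaussianIntegral.
Context {R : realType}.
Local Notation mu := (@lebesgue_measure R).
Local Notation gauss := (@normal_prob R 0 1).

Lemma integral_normal_nnsfun (m s : R) (f : {nnsfun _ >-> R}) :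
  (\int[normal_prob m s]_x (f x)%:E =
   \int[mu]_x ((f x)%:E * (normal_pdf m s x)%:E))%E.
Proof.
under [LHS]eq_integral do rewrite fimfunE -fsumEFin//.
rewrite [LHS]ge0_integral_fsum//; last 2 first.
  - by move=> r; exact/measurable_EFinP/measurableT_comp.
  - by move=> n x _; rewrite EFinM nnfun_muleindic_ge0.
under [RHS]eq_integral.
  move=> x xD; rewrite fimfunE -fsumEFin// muleC ge0_mule_fsumr; last first.
    by move=> r; rewrite EFinM nnfun_muleindic_ge0.
  over.
rewrite [RHS]ge0_integral_fsum//; last 2 first.
  - move=> r; apply/measurable_EFinP; apply: measurable_funM => //.
      exact: measurable_normal_pdf.
    by apply: measurable_funM.
  - move=> n x _; rewrite EFinM mule_ge0//; last by rewrite nnfun_muleindic_ge0.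
    by rewrite lee_fin normal_pdf_ge0.
apply: eq_fsbigr => r _.
rewrite integralZl_indic_nnsfun// integral_indic//= setIT.
rewrite /normal_prob [in LHS]integral_mkcond/=.
have [r0|r0] := leP 0 r; last first.
  rewrite (_ : f @^-1` [set r] = set0); last exact: preimage_nnfun0.
  rewrite patch_set0 integral0 mule0; apply/esym/integral0_eq => x _.
  by rewrite indicE in_set0 mulr0 mule0.
rewrite -ge0_integralZl//; last 2 first.
  - apply/(measurable_restrictT _ _).1 => //.
    apply/measurable_funTS/measurable_EFinP; exact: measurable_normal_pdf.
  - by move=> x _; rewrite patchE; case: ifP => // _; rewrite lee_fin normal_pdf_ge0.
apply: eq_integral => x _; rewrite patchE indicE; case: ifP => _.
  by rewrite -!EFinM mulr1 mulrC.
by rewrite mule0 mulr0 mule0.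
Qed.

Lemma integral_normal_prob (m s : R) (f : _ -> \bar R) :
  measurable_fun setT f -> (forall x, 0 <= f x)%E ->
  (\int[normal_prob m s]_x f x = \int[mu]_x (f x * (normal_pdf m s x)%:E))%E.
Proof.
move=> mf f0.
pose f_ := nnsfun_approx measurableT mf.
have mp : measurable_fun setT (EFin \o normal_pdf m s).
  by apply/measurable_EFinP; exact: measurable_normal_pdf.
transitivity (lim (\int[normal_prob m s]_x (f_ n x)%:E @[n --> \oo])%E).
  rewrite -monotone_convergence//=.
  - apply: eq_integral => ? /[!inE] xD; apply/esym/cvg_lim => //=.
    exact: cvg_nnsfun_approx.
  - by move=> n; exact/measurable_EFinP/measurable_funTS.
  - by move=> n ? _; rewrite lee_fin.
  - by move=> ? _ ? ? mn; rewrite lee_fin; exact/lefP/nd_nnsfun_approx.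
transitivity (lim (\int[mu]_x ((f_ n x)%:E * (normal_pdf m s x)%:E) @[n --> \oo])%E).
  by apply: congr_lim; apply/funext => n /=; exact: integral_normal_nnsfun.
rewrite -monotone_convergence//=.
- apply: eq_integral => x _; apply/cvg_lim => //.
  under eq_fun do rewrite muleC.
  rewrite muleC; apply: cvgeZl => //; exact: cvg_nnsfun_approx.
- by move=> n; apply: emeasurable_funM => //; exact/measurable_EFinP.
- by move=> n x _; rewrite mule_ge0// lee_fin// normal_pdf_ge0.
- move=> x _ a b ab; apply: lee_wpmul2r; first by rewrite lee_fin normal_pdf_ge0.
  by rewrite lee_fin; exact/lefP/nd_nnsfun_approx.
Qed.

Lemma measurable_expR_quad (a b k : R) :
  measurable_fun setT (fun x : R => expR (a * x ^+ 2 + b * x + k)).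
Proof.
apply: measurableT_comp => //; apply: measurable_funD => //.
apply: measurable_funD; first by apply: measurable_funM => //; exact: measurable_funX.
exact: measurable_funM.
Qed.

(** Completing the square: with w = 1 - 2a, the integrand times the standard density is a constant
    times the normal density of mean b/w and variance 1/w, which has mass one. *)
Lemma integral_gauss_expR_quad (a b k : R) : 2 * a < 1 ->
  (\int[gauss]_x (expR (a * x ^+ 2 + b * x + k))%:E =
   ((Num.sqrt (1 - 2 * a))^-1 * expR (k + b ^+ 2 / (2 * (1 - 2 * a))))%:E)%E.
Proof.
move=> a1; set w := 1 - 2 * a; have w0 : 0 < w by rewrite /w; lra.
rewrite integral_normal_prob; last 2 first.
- by apply/measurable_EFinP; exact: measurable_expR_quad.
- by move=> x; rewrite lee_fin expR_ge0.
have sw0 : (Num.sqrt w)^-1 != 0 by rewrite invr_neq0// gt_eqF// sqrtr_gt0.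
set C := (_ * expR (k + _)).
transitivity (\int[mu]_x (C%:E * (normal_pdf (b / w) (Num.sqrt w)^-1 x)%:E))%E.
  apply: eq_integral => x _; rewrite -!EFinM; congr EFin.
  rewrite !normal_pdfE ?oner_neq0// /normal_peak /normal_fun.
  have -> : Num.sqrt ((Num.sqrt w)^-1 ^+ 2 * pi *+ 2) =
            (Num.sqrt w)^-1 * Num.sqrt (1 ^+ 2 * pi *+ 2).
    rewrite -mulrnAr sqrtrM ?sqr_ge0// sqrtr_sqr ger0_norm ?invr_ge0 ?sqrtr_ge0//.
    by rewrite expr1n mul1r.
  rewrite exprVn sqr_sqrtr ?ltW// /C.
  set q := Num.sqrt (_ *+ 2).
  have q0 : q != 0.
    by rewrite gt_eqF// sqrtr_gt0 expr1n mul1r mulrn_wgt0// pi_gt0.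
  have sne : Num.sqrt w != 0 by rewrite gt_eqF// sqrtr_gt0.
  transitivity (q^-1 * (expR (k + b ^+ 2 / (2 * w)) *
     expR (- (x - b / w) ^+ 2 / (w^-1 *+ 2)))); last first.
    by field; apply/andP.
  rewrite mulrCA -!expRD; congr (_ * expR _).
  rewrite /w; field; rewrite /w in w0; lra.
rewrite ge0_integralZl//.
- by rewrite integral_normal_pdf mule1.
- by apply/measurable_EFinP; exact: measurable_normal_pdf.
- by move=> x _; rewrite lee_fin normal_pdf_ge0.
- by rewrite lee_fin mulr_ge0 ?expR_ge0// invr_ge0 sqrtr_ge0.
Qed.

End GaussianIntegral.

(** * The iterated expectation *)

Section GexpTheory.
Context {R : realType}.
Local Notation gauss := (@normal_prob R 0 1).
Implicit Types (F G : (nat -> R) -> \bar R).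

Definition scons (x : R) (s : nat -> R) : nat -> R :=
  fun t => if t == 0%N then x else s t.-1.

Lemma GexpS k F : Gexp k.+1 F = (\int[gauss]_x Gexp k (fun s => F (scons x s)))%E.
Proof. by []. Qed.

(* No measurability is needed here: the integral of a nonnegative function is
   a supremum over the simple functions below it. *)
Lemma le_integral_nonneg d (T : measurableType d) (mu : {measure set T -> \bar R})
    (f g : T -> \bar R) :
  (forall x, 0 <= f x)%E -> (forall x, f x <= g x)%E ->
  (\int[mu]_x f x <= \int[mu]_x g x)%E.
Proof.
move=> f0 fg; have g0 x : (0 <= g x)%E by exact: le_trans (fg x).
rewrite !ge0_integralTE//; apply: ereal_sup_le => /= _ [h hf <-].
by exists h => // x; exact: le_trans (hf x) (fg x).
Qed.

(** Simple functions below [f] and [g] add up to one below [f + g]. Without measurability only this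
    direction is available; it is the one that bounds a sum of average powers by the average of the
    total power. *)
Lemma integral_nonneg_superD d (T : measurableType d)
    (mu : {measure set T -> \bar R}) (f g : T -> \bar R) :
  (forall x, 0 <= f x)%E -> (forall x, 0 <= g x)%E ->
  (\int[mu]_x f x + \int[mu]_x g x <= \int[mu]_x (f x + g x))%E.
Proof.
move=> f0 g0; have fg0 x : (0 <= f x + g x)%E by exact: adde_ge0.
set Z := (X in (_ <= X)%E).
have Z0 : (0 <= Z)%E by exact: integral_ge0.
have [->|Zy] := eqVneq Z +oo%E; first by rewrite leey.
have Zfin : Z \is a fin_num by rewrite ge0_fin_numE// ltey.
have If0 : (0 <= \int[mu]_x f x)%E by exact: integral_ge0.
have Iff : (\int[mu]_x f x)%E \is a fin_num.
  rewrite ge0_fin_numE//; apply: le_lt_trans (_ : Z < +oo)%E; last by rewrite ltey.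
  by apply: le_integral_nonneg => // x; rewrite leeDl.
(* All quantities are finite now, so the two suprema are treated one at a time by moving the other
   term across the inequality. *)
rewrite addeC -leeBrDr// [leLHS]ge0_integralTE//.
apply: ge_ereal_sup => _ /= [h' h'g <-].
rewrite leeBrDr// addeC.
have sh' : sintegral mu h' \is a fin_num.
  rewrite ge0_fin_numE ?sintegral_ge0//.
  apply: le_lt_trans (_ : Z < +oo)%E; last by rewrite ltey.
  rewrite /Z ge0_integralTE//; apply: ereal_sup_ubound; exists h' => //= x.
  by apply: le_trans (h'g x) _; rewrite leeDr.
rewrite -leeBrDr// ge0_integralTE//.
apply: ge_ereal_sup => _ /= [h hf <-].
rewrite leeBrDr// -sintegralD /Z ge0_integralTE//.
by apply: ereal_sup_ubound; exists (h \+ h')%R => //= x; rewrite EFinD leeD.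
Qed.

Lemma Gexp_ge0 k F : (forall s, 0 <= F s)%E -> (0 <= Gexp k F)%E.
Proof.
elim: k F => [|k IH] F F0; first exact: F0.
rewrite GexpS; apply: integral_ge0 => x _.
by apply: IH.
Qed.

Lemma le_Gexp k F G : (forall s, 0 <= F s)%E -> (forall s, F s <= G s)%E ->
  (Gexp k F <= Gexp k G)%E.
Proof.
elim: k F G => [|k IH] F G F0 FG; first exact: FG.
rewrite !GexpS.
by apply: le_integral_nonneg => x; [exact: Gexp_ge0|exact: IH].
Qed.

Lemma Gexp_cst k (c : R) : Gexp k (fun=> c%:E) = c%:E.
Proof.
elim: k => [|k IH] //; rewrite GexpS; under eq_integral do rewrite IH.
by rewrite integral_cst//= probability_setT mule1.
Qed.

Lemma Gexp_superD k F G : (forall s, 0 <= F s)%E -> (forall s, 0 <= G s)%E ->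
  (Gexp k F + Gexp k G <= Gexp k (fun s => F s + G s))%E.
Proof.
elim: k F G => [|k IH] F G F0 G0 //; rewrite !GexpS.
apply: le_trans (integral_nonneg_superD _ _ _) _; [by move=> x; exact: Gexp_ge0..|].
apply: le_integral_nonneg => x; last exact: IH.
by apply: adde_ge0; exact: Gexp_ge0.
Qed.

Lemma Gexp_super_sum k (I : Type) (r : seq I) (F : I -> (nat -> R) -> \bar R) :
  (forall i s, 0 <= F i s)%E ->
  (\sum_(i <- r) Gexp k (F i) <= Gexp k (fun s => \sum_(i <- r) F i s))%E.
Proof.
move=> F0; elim: r => [|i r IH].
  by rewrite big_nil; apply: Gexp_ge0 => s; rewrite big_nil.
rewrite big_cons; apply: le_trans (leeD2l _ IH) _.
apply: le_trans (Gexp_superD _ _ _) _ => //; first by move=> s; exact: sume_ge0.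
apply: le_Gexp => s; last by rewrite big_cons.
by apply: adde_ge0 => //; exact: sume_ge0.
Qed.

(** The probabilistic method. Comparing [F] with a nonnegative constant uses only monotonicity. *)
Lemma Gexp_lt_ex k F (a : R) : (Gexp k F < a%:E)%E -> 0 <= a ->
  exists s, (F s < a%:E)%E.
Proof.
move=> Fa a0; apply: contrapT => /forallNP nF; move: Fa; apply/negP; rewrite -leNgt.
rewrite -[leLHS](Gexp_cst k); apply: le_Gexp => s; first by rewrite lee_fin.
by rewrite leNgt; apply/negP.
Qed.

Lemma integral_gauss_sum_expR_quad (I : Type) (r : seq I) (w a b k : I -> R) :
  (forall i, 0 <= w i) -> (forall i, 2 * a i < 1) ->
  (\int[gauss]_x (\sum_(i <- r) w i * expR (a i * x ^+ 2 + b i * x + k i))%:E =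
   (\sum_(i <- r) w i * ((Num.sqrt (1 - 2 * a i))^-1 *
      expR (k i + b i ^+ 2 / (2 * (1 - 2 * a i)))))%:E)%E.
Proof.
move=> w0 a1; under eq_integral do rewrite -sumEFin.
have mE i : measurable_fun [set: R]
    (fun x => (expR (a i * x ^+ 2 + b i * x + k i))%:E).
  by apply/measurable_EFinP; exact: measurable_expR_quad.
rewrite ge0_integral_sum//.
- rewrite -sumEFin; apply: eq_bigr => i _; under eq_integral do rewrite EFinM.
  rewrite ge0_integralZl//; last by rewrite lee_fin.
  + by rewrite EFinM integral_gauss_expR_quad.
  + exact: mE.
- move=> i; apply/measurable_EFinP; apply: measurable_funM => //.
  exact: measurable_expR_quad.
- by move=> i x _; rewrite lee_fin mulr_ge0// expR_ge0.
Qed.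

(** The weights make the induction work: the factor of coordinate 0 is absorbed into [w] before the
    inner coordinates are integrated. *)
Lemma Gexp_sum_expR_quad k (I : Type) (r : seq I) (w : I -> R) (a b c : I -> nat -> R) :
  (forall i, 0 <= w i) -> (forall i t, 2 * a i t < 1) ->
  Gexp k (fun s => (\sum_(i <- r) w i *
    expR (\sum_(t < k) (a i t * s t ^+ 2 + b i t * s t + c i t)))%:E) =
  (\sum_(i <- r) w i * \prod_(t < k) ((Num.sqrt (1 - 2 * a i t))^-1 *
      expR (c i t + b i t ^+ 2 / (2 * (1 - 2 * a i t)))))%:E.
Proof.
move=> + a1; elim: k w a b c a1 => [|k IH] w a b c a1 w0.
  by rewrite /=; congr EFin; apply: eq_bigr => i _; rewrite !big_ord0 expR0.
rewrite GexpS.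
pose E i := \prod_(t < k) ((Num.sqrt (1 - 2 * a i t.+1))^-1 *
      expR (c i t.+1 + b i t.+1 ^+ 2 / (2 * (1 - 2 * a i t.+1)))).
have E0 i : 0 <= E i.
  by apply: prodr_ge0 => t _; rewrite mulr_ge0 ?expR_ge0// invr_ge0 sqrtr_ge0.
transitivity (\int[gauss]_x (\sum_(i <- r) (w i * E i) *
   expR (a i 0%N * x ^+ 2 + b i 0%N * x + c i 0%N))%:E)%E.
  apply: eq_integral => x _.
  rewrite [RHS](_ : _ = (\sum_(i <- r) (w i * expR (a i 0%N * x ^+ 2 + b i 0%N * x + c i 0%N)) * E i)%:E); last first.
    by congr EFin; apply: eq_bigr => i _; rewrite mulrAC.
  rewrite -(IH _ (fun i t => a i t.+1) (fun i t => b i t.+1) (fun i t => c i t.+1))//.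
  - congr (Gexp k _); apply/funext => s; congr EFin; apply: eq_bigr => i _.
    by rewrite big_ord_recl /= expRD mulrA.
  - by move=> i; rewrite mulr_ge0 ?expR_ge0.
rewrite integral_gauss_sum_expR_quad//; last by move=> i; rewrite mulr_ge0.
congr EFin; apply: eq_bigr => i _.
by rewrite big_ord_recl /= -mulrA; congr (_ * _); rewrite mulrC.
Qed.

End GexpTheory.

(** * Exponential moments of quadratic forms in two independent Gaussians *)

Section GaussianQuadratic.
Context {R : realType}.
Local Notation gauss := (@normal_prob R 0 1).

(* For independent centred Gaussian V, V' of variances s, s', the mean of
   exp ((p V^2 + 2 q V V' + r V'^2) / 2) is [qdet]^(-1/2). *)
Definition qdet (p q r s s' : R) : R := (1 - s * p) * (1 - s' * r) - s * s' * q ^+ 2.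

Definition qform (p q r v v' : R) : R :=
  (p * v ^+ 2 + 2 * q * v * v' + r * v' ^+ 2) / 2.

(** The mean of [expR (qform p q r (b + V) (b' + V'))] for independent centred Gaussian V, V' of
    variances [s], [s']. *)
Definition qmean (p q r s s' b b' : R) : R :=
  let d := p * r - q ^+ 2 in
  (Num.sqrt (qdet p q r s s'))^-1 *
  expR (((p - s' * d) * b ^+ 2 + 2 * q * b * b' + (r - s * d) * b' ^+ 2) /
        (2 * qdet p q r s s')).

Lemma qmean0 p q r b b' : qmean p q r 0 0 b b' = expR (qform p q r b b').
Proof.
rewrite /qmean /qform /qdet !mul0r !subr0 mulr1 sqrtr1 invr1 mul1r.
by rewrite mulr1.
Qed.

(** [qdet] is affine in each variance separately, and an affine function positive at both ends of an
    interval is positive inside. This is applied first in [s], then in [s']. *)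
Lemma qdet_gt0 p q r S S' s s' :
  0 <= s <= S -> 0 <= s' <= S' ->
  0 < 1 - S * p -> 0 < 1 - S' * r -> 0 < qdet p q r S S' ->
  0 < qdet p q r s s'.
Proof.
rewrite /qdet => /andP[s0 sS] /andP[s0' sS'] p1 r1 D.
have aff (u v t T : R) : 0 <= t <= T -> 0 < u -> 0 < u + v * T -> 0 < u + v * t.
  move=> /andP[t0 tT] u0 uvT; have [v0|v0] := leP 0 v.
    by rewrite ltr_pwDl// mulr_ge0.
  by apply: lt_le_trans uvT _; rewrite lerD2l ler_wnM2l// ltW.
have H (x : R) : 0 <= x <= S -> 0 < 1 - x * p.
  by move=> xS; have := aff 1 (- p) x S xS; rewrite !mulNr ![p * _]mulrC; apply.
have HS' : 0 < (1 - s * p) * (1 - S' * r) - s * S' * q ^+ 2.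
  have := aff (1 - S' * r) (- p * (1 - S' * r) - S' * q ^+ 2) s S.
  rewrite s0 sS => /(_ isT r1); set A := (X in (0 < X -> _) -> _); set B := (X in (_ -> 0 < X) -> _).
  have -> : A = (1 - S * p) * (1 - S' * r) - S * S' * q ^+ 2 by rewrite /A; ring.
  have -> : B = (1 - s * p) * (1 - S' * r) - s * S' * q ^+ 2 by rewrite /B; ring.
  exact.
have := aff (1 - s * p) (- r * (1 - s * p) - s * q ^+ 2) s' S'.
rewrite s0' sS' => /(_ isT (H _ _)); rewrite s0 sS => /(_ isT).
set A := (X in (0 < X -> _) -> _); set B := (X in (_ -> 0 < X) -> _).
have -> : A = (1 - s * p) * (1 - S' * r) - s * S' * q ^+ 2 by rewrite /A; ring.
have -> : B = (1 - s * p) * (1 - s' * r) - s * s' * q ^+ 2 by rewrite /B; ring.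
exact.
Qed.

Section step.
Variables (p q r s s' b b' c c' : R).
Let d := p * r - q ^+ 2.
Let D := qdet p q r s s'.
Let a := ((p - s' * d) * c ^+ 2 + 2 * q * c * c' + (r - s * d) * c' ^+ 2) / (2 * D).
Let l := ((p - s' * d) * b * c + q * (b * c' + b' * c) + (r - s * d) * b' * c') / D.
Let k := ((p - s' * d) * b ^+ 2 + 2 * q * b * b' + (r - s * d) * b' ^+ 2) / (2 * D).
Let D2 := qdet p q r (s + c ^+ 2) (s' + c' ^+ 2).
Hypotheses (D0 : 0 < D) (D20 : 0 < D2) (cc : c * c' = 0).

Lemma qmean_shift x : qmean p q r s s' (b + c * x) (b' + c' * x) =
  (Num.sqrt D)^-1 * expR (a * x ^+ 2 + l * x + k).
Proof.
rewrite /qmean -/D -/d; congr (_ * expR _); rewrite /a /l /k.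
by field; rewrite gt_eqF.
Qed.

(** The normalization of the completed square is a ratio of successive determinants, so the square
    roots telescope over the letters. *)
Let wE : 1 - 2 * a = D2 / D.
Proof.
have Dn : D != 0 by rewrite gt_eqF.
apply: (mulIf Dn); rewrite divfK// /a mulrBl mul1r.
transitivity (D - ((p - s' * d) * c ^+ 2 + 2 * q * c * c' + (r - s * d) * c' ^+ 2)).
  by field.
rewrite /D /D2 /d /qdet; move/eqP: cc; rewrite mulf_eq0 => /orP[] /eqP ->; ring.
Qed.

Lemma qmean_step_lt1 : 2 * a < 1.
Proof. by rewrite -subr_gt0 wE divr_gt0. Qed.

(** Averaging over one more letter raises the variances by [c ^+ 2] and [c' ^+ 2]. As [c * c' = 0],
    the letter enters only one of the two variables, which keeps them independent. *)
Lemma qmean_step :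
  (Num.sqrt D)^-1 * ((Num.sqrt (1 - 2 * a))^-1 * expR (k + l ^+ 2 / (2 * (1 - 2 * a)))) =
  qmean p q r (s + c ^+ 2) (s' + c' ^+ 2) b b'.
Proof.
have Dn : D != 0 by rewrite gt_eqF.
have D2n : D2 != 0 by rewrite gt_eqF.
have E : k + l ^+ 2 / (2 * (1 - 2 * a)) =
    ((p - (s' + c' ^+ 2) * d) * b ^+ 2 + 2 * q * b * b' + (r - (s + c ^+ 2) * d) * b' ^+ 2) /
        (2 * D2).
  have -> : k + l ^+ 2 / (2 * (1 - 2 * a)) = (k * (2 * D) * D2 + (l * D) ^+ 2) / (2 * D * D2).
    by rewrite wE; field; rewrite Dn D2n.
  have -> : k * (2 * D) = (p - s' * d) * b ^+ 2 + 2 * q * b * b' + (r - s * d) * b' ^+ 2.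
    by rewrite /k; field.
  have -> : l * D = (p - s' * d) * b * c + q * (b * c' + b' * c) + (r - s * d) * b' * c'.
    by rewrite /l; field.
  have -> : 2 * D * D2 = 2 * D2 * D by ring.
  rewrite [RHS](_ : _ = ((p - (s' + c' ^+ 2) * d) * b ^+ 2 + 2 * q * b * b' + (r - (s + c ^+ 2) * d) * b' ^+ 2) * D /
        (2 * D2 * D)); last by field; rewrite Dn D2n.
  congr (_ / _); rewrite /D2 /D /d /qdet.
  move/eqP: cc; rewrite mulf_eq0 => /orP[] /eqP ->; ring.
rewrite E mulrA /qmean -/D2 -/d; congr (_ * _).
rewrite wE -invfM -sqrtrM ?ltW//; congr (Num.sqrt _)^-1.
by rewrite mulrC divfK.
Qed.
End step.

(** Positivity of [qdet] is asked for all smaller variances because the induction passes through the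
    partial sums of the squared coefficients. *)
Lemma Gexp_sum_qform k (I : Type) (rs : seq I) (w p q r b b' : I -> R)
    (c c' : I -> nat -> R) :
  (forall i, 0 <= w i) -> (forall i t, c i t * c' i t = 0) ->
  (forall i s s', 0 <= s <= \sum_(t < k) c i t ^+ 2 ->
     0 <= s' <= \sum_(t < k) c' i t ^+ 2 -> 0 < qdet (p i) (q i) (r i) s s') ->
  Gexp k (fun x => (\sum_(i <- rs) w i * expR (qform (p i) (q i) (r i)
     (b i + \sum_(t < k) c i t * x t) (b' i + \sum_(t < k) c' i t * x t)))%:E) =
  (\sum_(i <- rs) w i * qmean (p i) (q i) (r i) (\sum_(t < k) c i t ^+ 2)
     (\sum_(t < k) c' i t ^+ 2) (b i) (b' i))%:E.
Proof.
move=> w0; elim: k b b' c c' => [|k IH] b b' c c' cc Hq.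
  by congr EFin; apply: eq_bigr => i _; rewrite !big_ord0 !addr0 qmean0.
rewrite GexpS.
pose S i := \sum_(t < k) c i t.+1 ^+ 2.
pose S' i := \sum_(t < k) c' i t.+1 ^+ 2.
have S0 i : 0 <= S i by apply: sumr_ge0 => t _; exact: sqr_ge0.
have S0' i : 0 <= S' i by apply: sumr_ge0 => t _; exact: sqr_ge0.
have SE i : \sum_(t < k.+1) c i t ^+ 2 = S i + c i 0%N ^+ 2.
  by rewrite big_ord_recl addrC.
have SE' i : \sum_(t < k.+1) c' i t ^+ 2 = S' i + c' i 0%N ^+ 2.
  by rewrite big_ord_recl addrC.
have leS i : S i <= S i + c i 0%N ^+ 2 by rewrite lerDl sqr_ge0.
have leS' i : S' i <= S' i + c' i 0%N ^+ 2 by rewrite lerDl sqr_ge0.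
have Dt i : 0 < qdet (p i) (q i) (r i) (S i) (S' i).
  by apply: Hq; rewrite ?SE ?SE' ?S0 ?S0' ?leS ?leS'.
have D2 i : 0 < qdet (p i) (q i) (r i) (S i + c i 0%N ^+ 2) (S' i + c' i 0%N ^+ 2).
  by apply: Hq; rewrite ?SE ?SE' lexx ?andbT addr_ge0 ?sqr_ge0.
under eq_integral => x _.
  rewrite [X in Gexp k X](_ : _ = (fun y : nat -> R => (\sum_(i <- rs) w i * expR (qform (p i) (q i) (r i)
     ((b i + c i 0%N * x) + \sum_(t < k) c i t.+1 * y t)
     ((b' i + c' i 0%N * x) + \sum_(t < k) c' i t.+1 * y t)))%:E)); last first.
    apply/funext => y; congr EFin; apply: eq_bigr => i _; congr (_ * expR _).
    by rewrite !big_ord_recl /= !addrA.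
  rewrite (IH _ _ (fun i t => c i t.+1) (fun i t => c' i t.+1)); last 2 first.
  - by move=> i t; exact: cc.
  - move=> i s s' /andP[s0 sS] /andP[s0' sS']; apply: Hq; rewrite ?SE ?SE' ?s0 ?s0' /=.
      exact: le_trans sS (leS i).
    exact: le_trans sS' (leS' i).
  under eq_bigr => i _ do rewrite qmean_shift// mulrA.
  over.
rewrite /= integral_gauss_sum_expR_quad; last 2 first.
- by move=> i; rewrite mulr_ge0// invr_ge0 sqrtr_ge0.
- by move=> i; apply: qmean_step_lt1 => //; exact: cc.
congr EFin; apply: eq_bigr => i _; rewrite -mulrA; congr (_ * _).
by rewrite SE SE' qmean_step//; exact: cc.
Qed.
End GaussianQuadratic.

(** * Codebook selection *)

Section RandomCodebook.
Context {R : realType} (Lab J : finType) (l0 : Lab).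
Variables (A B p q r : J -> R) (c c' : J -> Lab -> R).
Let S j := \sum_l c j l ^+ 2.
Let S' j := \sum_l c' j l ^+ 2.
Hypothesis A0 : forall j, 0 <= A j.
Hypothesis cc' : forall j l, c j l * c' j l = 0.
Hypothesis det1 : forall j, 0 < 1 - S j * p j.
Hypothesis det2 : forall j, 0 < 1 - S' j * r j.
Hypothesis det3 : forall j, 0 < qdet (p j) (q j) (r j) (S j) (S' j).
Hypothesis AB : forall j, A j * (Num.sqrt (qdet (p j) (q j) (r j) (S j) (S' j)))^-1 < B j.

Let G j (x : Lab -> R) : R := A j *
  expR (qform (p j) (q j) (r j) (\sum_l c j l * x l) (\sum_l c' j l * x l)).

Let G0 j x : 0 <= G j x.
Proof. by rewrite mulr_ge0 ?expR_ge0. Qed.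

Let B0 j : 0 <= B j.
Proof.
by apply: ltW; apply: le_lt_trans (AB j); rewrite mulr_ge0// invr_ge0 sqrtr_ge0.
Qed.

Let sum_enum (F : Lab -> R) :
  \sum_(t < #|Lab|) F (nth l0 (enum Lab) t) = \sum_l F l.
Proof.
rewrite -[RHS]big_enum /= (big_nth l0) big_mkord.
by rewrite cardE.
Qed.

(** First-moment argument: for i.i.d. normal letters the mean of the weighted sum is strictly below
    the right-hand side, so some sample is too. *)
Lemma exists_letter (wt : J -> R) : (forall j, 0 <= wt j) ->
  exists x : Lab -> R, \sum_j wt j * G j x <= \sum_j wt j * B j.
Proof.
move=> wt0.
(* With all weights zero the strict inequality is lost, and any letters do. *)
have [/forallP wtA0|] := boolP [forall j, wt j == 0].
  by exists (fun=> 0); rewrite !big1// => j _; rewrite (eqP (wtA0 j)) mul0r.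
rewrite negb_forall => /existsP[j0 wtj0].
have wtj0p : 0 < wt j0 by rewrite lt_neqAle eq_sym wtj0 wt0.
pose lab t := nth l0 (enum Lab) t.
have SE j : \sum_(t < #|Lab|) c j (lab t) ^+ 2 = S j.
  exact: (sum_enum (fun l => c j l ^+ 2)).
have SE' j : \sum_(t < #|Lab|) c' j (lab t) ^+ 2 = S' j.
  exact: (sum_enum (fun l => c' j l ^+ 2)).
have wA0 j : 0 <= wt j * A j by rewrite mulr_ge0.
have ccl j t : c j (lab t) * c' j (lab t) = 0 by exact: cc'.
have det j s s' : 0 <= s <= \sum_(t < #|Lab|) c j (lab t) ^+ 2 ->
     0 <= s' <= \sum_(t < #|Lab|) c' j (lab t) ^+ 2 -> 0 < qdet (p j) (q j) (r j) s s'.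
  by rewrite SE SE' => h h'; exact: qdet_gt0 h h' (det1 j) (det2 j) (det3 j).
have H := Gexp_sum_qform (index_enum J) (fun=> 0) (fun=> 0) wA0 ccl det.
move: H; set Z := (X in Gexp _ X) => H.
have lt : (Gexp #|Lab| Z < (\sum_j wt j * B j)%:E)%E.
  rewrite H lte_fin (bigD1 j0)//= [ltRHS](bigD1 j0)//= ltr_leD//.
    rewrite SE SE' -mulrA ltr_pM2l// /qmean !expr0n/= !mulr0 !addr0 mul0r expR0 mulr1.
    exact: AB.
  apply: ler_sum => j _; rewrite SE SE' -mulrA ler_wpM2l//.
  rewrite /qmean !expr0n/= !mulr0 !addr0 mul0r expR0 mulr1.
  exact: ltW (AB j).
case: (Gexp_lt_ex lt) => [|s].
  by apply: sumr_ge0 => j _; exact: mulr_ge0.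
rewrite /Z lte_fin => /ltW {}lt; exists (fun l => s (index l (enum Lab))).
have sumx (d : Lab -> R) : \sum_l d l * s (index l (enum Lab)) =
    0 + \sum_(t < #|Lab|) d (lab t) * s t.
  rewrite add0r -sum_enum; apply: eq_bigr => t _.
  by rewrite index_uniq ?enum_uniq// -cardE.
have GE j : wt j * G j (fun l => s (index l (enum Lab))) = wt j * A j *
  expR (qform (p j) (q j) (r j) (0 + \sum_(t < #|Lab|) c j (lab t) * s t)
     (0 + \sum_(t < #|Lab|) c' j (lab t) * s t)).
  by rewrite /G !sumx mulrA.
by under eq_bigr do rewrite GE.
Qed.

(* Method of conditional expectations: the letters are fixed one after the
   other, the future ones being accounted for by the factors [B j]. *)
Lemma exists_codebook m (wt : J -> R) : (forall j, 0 <= wt j) ->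
  exists X : nat -> Lab -> R,
    \sum_j wt j * \prod_(t < m) (A j * expR (qform (p j) (q j) (r j)
        (\sum_l c j l * X t l) (\sum_l c' j l * X t l)))
    <= \sum_j wt j * B j ^+ m.
Proof.
elim: m wt => [|m IH] wt wt0.
  by exists (fun _ _ => 0); apply: ler_sum => j _; rewrite big_ord0 expr0.
have [|x Hx] := @exists_letter (fun j => wt j * B j ^+ m).
  by move=> j; rewrite mulr_ge0// exprn_ge0.
have [|X HX] := IH (fun j => wt j * G j x).
  by move=> j; rewrite mulr_ge0.
exists (fun t => if t == 0%N then x else X t.-1).
apply: (@le_trans _ _ (\sum_j wt j * B j ^+ m * G j x)); last first.
  by apply: le_trans Hx _; apply: ler_sum => j _; rewrite exprSr mulrA.
under [leRHS]eq_bigr do rewrite mulrAC.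
apply: le_trans HX; apply: ler_sum => j _.
by rewrite big_ord_recl /= mulrA.
Qed.

End RandomCodebook.

(** * Error events *)

Section ErrorEvents.
Context {R : realType}.
Variables (s delta tau P : R).

(* Exponents of the Chernoff bounds, as quadratic polynomials in the noise
   letter z.  [Fail V]: the codeword sent, with signal v, misses the threshold,
   exponent -s ((z + v)^2 / 2V - z^2 / 2 + delta).  [Comp V]: a competitor with
   signal v' reaches it, exponent (z + v)^2 / 2V - (z + v - v')^2 / 2 + delta.
   [Pow]: a codeword with letters v violates the power constraint, exponent
   tau (v^2 - P). *)
Variant kind := Fail of R | Comp of R | Pow.

Definition kind_a (e : kind) : R :=
  match e with
  | Fail V => s * (1 - V^-1) / 2
  | Comp V => (V^-1 - 1) / 2
  | Pow => 0
  end.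

Definition kind_b (e : kind) (v v' : R) : R :=
  match e with
  | Fail V => - s * v / V
  | Comp V => v / V - (v - v')
  | Pow => 0
  end.

Definition kind_k (e : kind) (v v' : R) : R :=
  match e with
  | Fail V => - s * (v ^+ 2 / (2 * V) + delta)
  | Comp V => v ^+ 2 / (2 * V) - (v - v') ^+ 2 / 2 + delta
  | Pow => tau * (v ^+ 2 - P)
  end.

(** [kind_A], [kind_p], [kind_q] and [kind_r] describe what remains after integrating the noise
    letter: a constant times the exponential of a quadratic form in the two signals, as [kind_mean]
    verifies. *)
Definition kind_A (e : kind) : R :=
  match e with
  | Fail V => (Num.sqrt (1 - s * (1 - V^-1)))^-1 * expR (- s * delta)
  | Comp V => (Num.sqrt (2 - V^-1))^-1 * expR delta
  | Pow => expR (- tau * P)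
  end.

Definition kind_p (e : kind) : R :=
  match e with
  | Fail V => - s * (1 - s) / (V - s * (V - 1))
  | Comp V => (1 - V) / (2 * V - 1)
  | Pow => 2 * tau
  end.

Definition kind_q (e : kind) : R :=
  match e with Comp V => V / (2 * V - 1) | _ => 0 end.

Definition kind_r (e : kind) : R :=
  match e with Comp V => (1 - V) / (2 * V - 1) | _ => 0 end.

Definition kind_ok (e : kind) : bool :=
  match e with Fail V | Comp V => 1 <= V | Pow => true end.

Hypotheses (s0 : 0 < s) (s1 : s < 1).

Let W_gt0 V : 1 <= V -> 0 < V - s * (V - 1).
Proof.
move=> V1; have -> : V - s * (V - 1) = V * (1 - s) + s by ring.
by rewrite ltr_wpDl// mulr_ge0// ?subr_ge0 ?ltW//; apply: lt_le_trans V1.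
Qed.

Lemma kind_a_lt1 e : kind_ok e -> 2 * kind_a e < 1.
Proof.
case: e => [V|V|] //= V1; rewrite ?mulr0 ?ltr01//.
- have Vi : 0 < V^-1 <= 1 by rewrite invr_gt0 invf_le1 ?V1 ?andbT; lra.
  case/andP: Vi; set x := V^-1 => Vi _; have := mulr_gt0 s0 Vi.
  by have := s1; lra.
- have Vi : 0 < V^-1 <= 1 by rewrite invr_gt0 invf_le1 ?V1 ?andbT; lra.
  by case/andP: Vi => ? ?; lra.
Qed.

Lemma kind_mean e v v' : kind_ok e ->
  (Num.sqrt (1 - 2 * kind_a e))^-1 *
    expR (kind_k e v v' + kind_b e v v' ^+ 2 / (2 * (1 - 2 * kind_a e))) =
  kind_A e * expR (qform (kind_p e) (kind_q e) (kind_r e) v v').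
Proof.
case: e => [V|V|] /= V1; rewrite /qform.
- have V0 : 0 < V by lra.
  have Vn : V != 0 by rewrite gt_eqF.
  have W : V - s * (V - 1) != 0 by rewrite gt_eqF// W_gt0.
  rewrite (_ : 1 - 2 * (s * (1 - V^-1) / 2) = 1 - s * (1 - V^-1)); last by field.
  rewrite -[RHS]mulrA -[X in _ = _ * X]expRD; congr (_ * expR _); field.
  by rewrite W Vn.
- have V0 : 0 < V by lra.
  have Vn : V != 0 by rewrite gt_eqF.
  have W : 2 * V - 1 != 0 by rewrite gt_eqF//; lra.
  rewrite (_ : 1 - 2 * ((V^-1 - 1) / 2) = 2 - V^-1); last by field.
  rewrite -[RHS]mulrA -[X in _ = _ * X]expRD; congr (_ * expR _); field.
  by rewrite W Vn.
- rewrite mulr0 subr0 sqrtr1 invr1 mul1r -[RHS]expRD; congr expR; by field.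
Qed.

Lemma kind_fail_mean V : 1 <= V -> let S := V - 1 in
  0 < 1 - S * kind_p (Fail V) /\
  kind_A (Fail V) * (Num.sqrt (1 - S * kind_p (Fail V)))^-1 <=
    (Num.sqrt (1 - s ^+ 2))^-1 * expR (- s * delta).
Proof.
move=> V1 /=.
have V0 : 0 < V by lra.
have Vn : V != 0 by rewrite gt_eqF.
have W0 := W_gt0 V1.
have W : V - s * (V - 1) != 0 by rewrite gt_eqF.
have Vi : 0 < V^-1 <= 1 by rewrite invr_gt0 V0 invf_le1.
have D0 : 0 < 1 - (V - 1) * (- s * (1 - s) / (V - s * (V - 1))).
  rewrite mulrA -mulNr addrC ltr_wpDl// divr_ge0 ?(ltW W0)//.
  rewrite -mulrN mulr_ge0 ?subr_ge0// mulNr opprK mulr_ge0 ?subr_ge0 ?ltW//.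
split=> //; rewrite mulrAC ler_wpM2r ?expR_ge0//.
have w0 : 0 <= 1 - s * (1 - V^-1).
  rewrite (_ : _ - _ = (V - s * (V - 1)) / V); last by field.
  by rewrite divr_ge0 ?ltW.
rewrite -invfM -sqrtrM//.
have s20 : 0 < 1 - s ^+ 2 by rewrite subr_gt0 expr_lt1// ltW.
rewrite (_ : _ * (1 - (V - 1) * _) = 1 - s ^+ 2 * (1 - V^-1)); last first.
  by field; rewrite W Vn.
have le : 1 - s ^+ 2 <= 1 - s ^+ 2 * (1 - V^-1).
  case/andP: Vi => Vi _; rewrite lerD2l lerN2 ler_piMr ?sqr_ge0//.
  by rewrite gerBl ltW.
rewrite lef_pV2 ?posrE ?sqrtr_gt0//; last exact: lt_le_trans le.
by rewrite ler_sqrt// ltW//; exact: lt_le_trans le.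
Qed.

(** Since (2 - 1/V) V^2 / (2V - 1) = V, the mean per letter is exactly V^(-1/2) exp(delta): the
    capacity in nats up to the slack. *)
Lemma kind_comp_mean V : 1 <= V -> let S := V - 1 in
  let e := Comp V in
  [/\ 0 < 1 - S * kind_p e, 0 < 1 - S * kind_r e,
      0 < qdet (kind_p e) (kind_q e) (kind_r e) S S &
      kind_A e * (Num.sqrt (qdet (kind_p e) (kind_q e) (kind_r e) S S))^-1 =
        (Num.sqrt V)^-1 * expR delta].
Proof.
move=> V1 /=.
have V0 : 0 < V by lra.
have Vn : V != 0 by rewrite gt_eqF.
have W0 : 0 < 2 * V - 1 by lra.
have W : 2 * V - 1 != 0 by rewrite gt_eqF.
have D0 : 0 < 1 - (V - 1) * ((1 - V) / (2 * V - 1)).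
  rewrite mulrA -mulNr addrC ltr_wpDl// divr_ge0 ?(ltW W0)//.
  rewrite -mulrN opprB mulr_ge0 ?subr_ge0//.
have Vi : 0 < V^-1 <= 1 by rewrite invr_gt0 V0 invf_le1.
have QE : qdet ((1 - V) / (2 * V - 1)) (V / (2 * V - 1)) ((1 - V) / (2 * V - 1))
    (V - 1) (V - 1) = V ^+ 2 / (2 * V - 1).
  by rewrite /qdet; field.
rewrite QE; split => //.
  by rewrite divr_gt0// exprn_gt0.
rewrite mulrAC; congr (_ * _); rewrite -invfM -sqrtrM; last by case/andP: Vi => *; lra.
by congr (Num.sqrt _)^-1; field; rewrite Vn W.
Qed.

End ErrorEvents.

(** * Choice of the Chernoff parameters *)

Section ChernoffParameters.
Context {R : realType}.

Lemma exists_fail_parameter (delta : R) : 0 < delta ->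
  exists s B : R, [/\ 0 < s, s < 1, B < 1 &
    (Num.sqrt (1 - s ^+ 2))^-1 * expR (- s * delta) < B].
Proof.
(* For small s the factor is about exp(s^2/2 - s delta), which is below one when s < 2 delta; this
   choice also keeps s below 1/2. *)
move=> d0; pose s := delta / (2 * (1 + delta)).
have d1 : 0 < 2 * (1 + delta) by lra.
have sE : s * (2 * (1 + delta)) = delta by rewrite /s divfK// gt_eqF.
have s0 : 0 < s by rewrite divr_gt0.
have s1 : s < 1 by rewrite ltr_pdivrMr//; lra.
have s20 : 0 < 1 - s ^+ 2 by nra.
suff lt1 : (Num.sqrt (1 - s ^+ 2))^-1 * expR (- s * delta) < 1.
  exists s, ((1 + (Num.sqrt (1 - s ^+ 2))^-1 * expR (- s * delta)) / 2).
  by split => //; move: lt1; set q := _ * expR _; lra.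
rewrite mulrC ltr_pdivrMr ?sqrtr_gt0// mul1r.
rewrite -[ltLHS]ger0_norm ?expR_ge0// -sqrtr_sqr ltr_sqrt//.
rewrite -expRM_natl.
have E : expR (2%:R * (- s * delta)) * (1 + 2 * (s * delta)) <= 1.
  rewrite (_ : 2%:R * (- s * delta) = - (2 * (s * delta))); last by ring.
  rewrite expRN mulrC ler_pdivrMr ?expR_gt0// mul1r; exact: expR_ge1Dx.
have sd : 0 < s * delta by rewrite mulr_gt0.
rewrite -(ltr_pM2r (_ : 0 < 1 + 2 * (s * delta))); last by lra.
apply: le_lt_trans E _.
have s2 : s ^+ 2 = s * s by rewrite expr2.
by nra.
Qed.

Lemma exists_power_parameter (P P' : R) : 0 < P' -> P' < P ->
  exists tau B : R, [/\ 0 < tau, 0 < 1 - P' * (2 * tau), B < 1 &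
    expR (- tau * P) * (Num.sqrt (1 - P' * (2 * tau)))^-1 < B].
Proof.
move=> P0 PP; have P1 : 0 < P by lra.
(* Squaring and exp(2x) >= 1 + 2x reduce the claim to (1 - 2 tau P')(1 + 2 tau P) > 1; this [tau]
   maximizes the product, with value 1 + tau (P - P'). *)
pose tau := (P - P') / (4 * (P * P')).
have PP0 : 0 < P * P' by rewrite mulr_gt0.
have tE : tau * (4 * (P * P')) = P - P' by rewrite /tau divfK// gt_eqF//; lra.
have t0 : 0 < tau by rewrite divr_gt0//; lra.
have w0 : 0 < 1 - P' * (2 * tau).
  by rewrite -(pmulr_rgt0 _ P1); nra.
suff lt1 : expR (- tau * P) * (Num.sqrt (1 - P' * (2 * tau)))^-1 < 1.
  exists tau, ((1 + expR (- tau * P) * (Num.sqrt (1 - P' * (2 * tau)))^-1) / 2).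
  by split => //; move: lt1; set q := _ * _^-1; lra.
rewrite ltr_pdivrMr ?sqrtr_gt0// mul1r.
rewrite -[ltLHS]ger0_norm ?expR_ge0// -sqrtr_sqr ltr_sqrt//.
rewrite -expRM_natl.
have E : expR (2%:R * (- tau * P)) * (1 + 2 * (tau * P)) <= 1.
  rewrite (_ : 2%:R * (- tau * P) = - (2 * (tau * P))); last by ring.
  rewrite expRN mulrC ler_pdivrMr ?expR_gt0// mul1r; exact: expR_ge1Dx.
have tP : 0 < tau * P by rewrite mulr_gt0.
rewrite -(ltr_pM2r (_ : 0 < 1 + 2 * (tau * P))); last by lra.
apply: le_lt_trans E _.
have -> : (1 - P' * (2 * tau)) * (1 + 2 * (tau * P)) =
  1 + tau * (2 * (P - P') - tau * (4 * (P * P'))) by ring.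
by rewrite tE ltrDl mulr_gt0//; lra.
Qed.

End ChernoffParameters.

(** * Codeword labels and received signals *)

Section Codebook.
Context {R : realType}.
Variable kk : 'I_3 -> nat.

Definition subs : finType := {dffun forall j : 'I_3, 'I_(kk j).+1}.
Definition label : finType := ({j : 'I_3 & 'I_(kk j).+1} + subs)%type.
Implicit Types (u : subs) (S : {set 'I_3}).

(* [None] labels the codeword of the relay, which carries the whole triple. *)
Definition lab u (a : option 'I_3) : label :=
  if a is Some a then inl (Tagged (fun j => 'I_(kk j).+1) (u a)) else inr u.

Definition differ u u' : {set 'I_3} := [set a | u a != u' a]%SET.

Lemma differ_neq0 u u' : u' != u -> differ u u' != finset.set0.
Proof.
apply: contra => /eqP/finset.setP D; apply/eqP/ffunP => a; apply/esym/eqP.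
by move: (D a); rewrite !inE => /negbFE.
Qed.

Variables (h : 'I_3 -> R) (sp : R).

(* Signal received by node [r] from the codewords in [S] ([S] is irrelevant to
   the users, which only hear the relay). *)
Definition sigl (r : option 'I_3) S u (x : label -> R) : R :=
  if r is Some j then sp * h j * x (lab u None)
  else \sum_(a in S) sp * h a * x (lab u (Some a)).

Definition coef (r : option 'I_3) S u (l : label) : R :=
  if r is Some j then sp * h j * (l == lab u None)%:R
  else \sum_(a in S) sp * h a * (l == lab u (Some a))%:R.

Definition gain (r : option 'I_3) S : R :=
  if r is Some j then h j ^+ 2 else \sum_(a in S) h a ^+ 2.

Lemma sum_delta (T : finType) (l0 : T) (c : R) (x : T -> R) :
  \sum_l c * (l == l0)%:R * x l = c * x l0.
Proof.
rewrite (bigD1 l0)//= eqxx mulr1 big1 ?addr0// => l /negbTE ->.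
by rewrite mulr0 mul0r.
Qed.

Lemma sum_coef r S u x : \sum_l coef r S u l * x l = sigl r S u x.
Proof.
case: r => [j|]; rewrite /coef /sigl; first exact: sum_delta.
under eq_bigr do rewrite mulr_suml.
by rewrite exchange_big /=; apply: eq_bigr => a _; exact: sum_delta.
Qed.

Lemma lab_eq u u' a b : (lab u (Some a) == lab u' (Some b)) = (a == b) && (u a == u' a).
Proof.
rewrite /lab; apply/eqP/andP => [|[/eqP <- /eqP ->]//].
pose g (l : label) : {j : 'I_3 & 'I_(kk j).+1} := if l is inl t then t else Tagged _ (u a).
move=> /(congr1 g)/= E.
have ab : a = b := f_equal (@tag _ _) E.
by subst b; move/eqP: E; rewrite eq_Tagged /= => ->.
Qed.

Lemma coef_lab S u u' a : coef None S u (lab u' (Some a)) =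
  (a \in S)%:R * (u' a == u a)%:R * (sp * h a).
Proof.
rewrite /coef; under eq_bigr do rewrite lab_eq.
have [aS|aS] := boolP (a \in S); last first.
  rewrite !mul0r big1// => b bS; case: eqP => [ab|]; last by rewrite mulr0.
  by rewrite ab bS in aS.
rewrite (bigD1 a)//= eqxx /= big1 ?addr0; first by rewrite mul1r mulrC.
by move=> b /andP[_ ba]; rewrite eq_sym (negbTE ba) mulr0.
Qed.

Lemma sum_coef2 r S u : \sum_l coef r S u l ^+ 2 = sp ^+ 2 * gain r S.
Proof.
under eq_bigr do rewrite expr2; rewrite sum_coef; case: r => [j|]; rewrite /sigl /gain.
  by rewrite /coef eqxx mulr1 -expr2 exprMn.
rewrite mulr_sumr; apply: eq_bigr => a aS.
by rewrite coef_lab aS eqxx !mul1r -expr2 exprMn.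
Qed.

Lemma gain_ge0 r S : 0 <= gain r S.
Proof. by case: r => [j|]; rewrite /gain ?sqr_ge0// sumr_ge0// => a _; exact: sqr_ge0. Qed.

(** On the indices where [u] and [u'] differ they use different codewords, so their signals share no
    letter: true and competing signals are independent under a random codebook. *)
Lemma coef_orthogonal r u u' l : u' != u ->
  coef r (differ u u') u l * coef r (differ u u') u' l = 0.
Proof.
move=> uu'; case: r => [j|]; rewrite /coef.
  case: eqP => [->|_]; last by rewrite mulr0 mul0r.
  by case: eqP => [[E]|_]; [rewrite E eqxx in uu'|rewrite !mulr0].
rewrite -!/(coef None _ _ _).
case: l => [[a i]|v]; last by rewrite /coef big1 ?mul0r// => a _; rewrite mulr0.
have [ua|ua] := eqVneq i (u a).
  have -> : inl (existT (fun j => 'I_(kk j).+1) a i) = lab u (Some a) by rewrite ua.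
  rewrite !coef_lab inE; case: eqVneq => [|_]; first by rewrite /= !mul0r ?mulr0.
  by rewrite mulr0 mul0r mulr0.
(* A triple whose coordinate [a] is [i], so that [coef_lab] applies; the cast follows the dependence
   of the digit type on the user. *)
pose v : subs := [ffun j => if eqVneq j a is EqNotNeq E then
   cast_ord (congr1 (fun j => (kk j).+1) (esym E)) i else u j].
have vE : v a = i.
  by rewrite ffunE; case: eqVneq => [E|]; [exact: val_inj|rewrite eqxx].
have -> : inl (existT (fun j => 'I_(kk j).+1) a i) = lab v (Some a) by rewrite /lab vE.
by rewrite coef_lab vE (negbTE ua) mulr0 !mul0r.
Qed.

End Codebook.

(** * Threshold decoding and its error events *)

Section Decoding.
Context {R : realType}.
Variables (kk : 'I_3 -> nat) (h : 'I_3 -> R) (sp s delta tau P : R) (m : nat).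
Variable X : nat -> label kk -> R.
Local Notation subs := (subs kk).
Implicit Types (u : subs) (r : option 'I_3) (S : {set 'I_3}).

Definition outvar r S : R := 1 + sp ^+ 2 * gain h r S.

Lemma outvar_ge1 r S : 1 <= outvar r S.
Proof. by rewrite lerDl mulr_ge0 ?sqr_ge0 ?gain_ge0. Qed.

Definition sg r S u t : R := sigl h sp r S u (X t).

(** Information density of the codewords in [S] once the others are subtracted from the output,
    without its constant (m/2) ln V; it is centred for the true triple, hence the threshold -m
    delta. At a user it does not depend on [S]. *)
Definition metric r S u (y : nat -> R) : R :=
  \sum_(t < m) ((y t - sg r finset.setT u t + sg r S u t) ^+ 2 / (2 * outvar r S) -
                (y t - sg r finset.setT u t) ^+ 2 / 2).

Definition passes r u (y : nat -> R) : bool :=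
  [forall S : {set 'I_3}, (S != finset.set0) ==> (- (m%:R * delta) < metric r S u y)].

Definition decode r (own : pred subs) (y : nat -> R) : subs :=
  odflt [ffun j => ord0] [pick u | own u && passes r u y].

Definition fits (l : label kk) : bool := \sum_(t < m) (sp * X t l) ^+ 2 <= m%:R * P.

Definition cw t (l : label kk) : R := if fits l then sp * X t l else 0.

(** In order: the true triple fails the test for a set at a node, a competing triple passes at a
    node, a codeword of the true triple violates the power constraint. *)
Definition event : finType :=
  (option 'I_3 * {set 'I_3} + option 'I_3 * subs + option 'I_3)%type.

Definition knows r u u' : bool := if r is Some j then u' j == u j else true.

Definition ev_valid u (e : event) : bool :=
  match e with
  | inl (inl (_, A)) => A != finset.set0
  | inl (inr (r, u')) => (u' != u) && knows r u u'
  | inr _ => true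
  end.

(** The exponent of a power event contains no noise, so its node is arbitrary. *)
Definition ev_node (e : event) : option 'I_3 :=
  match e with inl (inl (r, _)) => r | inl (inr (r, _)) => r | inr _ => None end.

(** An invalid competitor gets zero coefficients and, in [ev_kind], variance 1, so that the codebook
    selection applies to every pair of a triple and an event. *)
Definition ev_coef u (e : event) (l : label kk) : R :=
  match e with
  | inl (inl (r, A)) => coef h sp r A u l
  | inl (inr (r, u')) => (ev_valid u e)%:R * coef h sp r (differ u u') u l
  | inr a => sp * (l == lab u a)%:R
  end.

Definition ev_coef' u (e : event) (l : label kk) : R :=
  match e with
  | inl (inr (r, u')) => (ev_valid u e)%:R * coef h sp r (differ u u') u' l
  | _ => 0
  end.

Definition ev_kind u (e : event) : kind :=
  match e with
  | inl (inl (r, A)) => Fail (outvar r A)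
  | inl (inr (r, u')) => Comp (if ev_valid u e then outvar r (differ u u') else 1)
  | inr _ => Pow
  end.

Definition ev_v u e t : R := \sum_l ev_coef u e l * X t l.
Definition ev_v' u e t : R := \sum_l ev_coef' u e l * X t l.

Definition ev_exp u e (z : nat -> R) : R :=
  \sum_(t < m) (kind_a s (ev_kind u e) * z t ^+ 2 +
    kind_b s (ev_kind u e) (ev_v u e t) (ev_v' u e t) * z t +
    kind_k s delta tau P (ev_kind u e) (ev_v u e t) (ev_v' u e t)).

Lemma ev_kind_ok u e : kind_ok (ev_kind u e).
Proof.
case: e => [[[r S]|[r u']]|a] //=; first exact: outvar_ge1.
by case: ifP => // _; exact: outvar_ge1.
Qed.

Lemma ev_coef_orthogonal u e l : ev_coef u e l * ev_coef' u e l = 0.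
Proof.
case: e => [[[r S]|[r u']]|a] /=; [by rewrite mulr0| |by rewrite mulr0].
case: andP => [[uu' _]|_]; last by rewrite !mul0r.
by rewrite !mul1r coef_orthogonal.
Qed.

Lemma sum_ev_coef2 u e : \sum_l ev_coef u e l ^+ 2 =
  match ev_kind u e with Fail V | Comp V => V - 1 | Pow => sp ^+ 2 end.
Proof.
case: e => [[[r S]|[r u']]|a] /=.
- by rewrite sum_coef2 /outvar addrC addKr.
- case: ifP => _; first by under eq_bigr do rewrite mul1r; rewrite sum_coef2 /outvar addrC addKr.
  by rewrite subrr big1// => l _; rewrite mul0r expr0n.
- under eq_bigr do rewrite expr2.
  by rewrite (sum_delta _ _ (fun l => sp * (l == lab u a)%:R)) eqxx mulr1 expr2.
Qed.

Lemma sum_ev_coef'2 u e : \sum_l ev_coef' u e l ^+ 2 =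
  match ev_kind u e with Comp V => V - 1 | _ => 0 end.
Proof.
case: e => [[[r S]|[r u']]|a] /=; [by rewrite big1// => l _; rewrite expr0n| |
  by rewrite big1// => l _; rewrite expr0n].
case: ifP => _; first by under eq_bigr do rewrite mul1r; rewrite sum_coef2 /outvar addrC addKr.
by rewrite subrr big1// => l _; rewrite mul0r expr0n.
Qed.

Definition good u (z : option 'I_3 -> nat -> R) : Prop :=
  forall e, ev_valid u e -> ev_exp u e (z (ev_node e)) < 0.

Lemma good_indicator u z :
  (~~ `[< good u z >])%:R <= \sum_(e | ev_valid u e) expR (ev_exp u e (z (ev_node e))).
Proof.
have s0 : 0 <= \sum_(e | ev_valid u e) expR (ev_exp u e (z (ev_node e))).
  by apply: sumr_ge0 => e _; exact: expR_ge0.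
case: asboolP => //= /existsNP[e /not_implyP[ve /negP]]; rewrite -leNgt => e0.
rewrite (bigD1 e)//= ler_wpDr//; first by apply: sumr_ge0 => ? _; exact: expR_ge0.
by rewrite -[leLHS]expR0 ler_expR.
Qed.

Lemma good_fits u z a : 0 < tau -> good u z -> fits (lab u a).
Proof.
move=> t0 /(_ (inr a) isT); rewrite /ev_exp /fits /=.
under eq_bigr do rewrite mul0r mul0r !add0r.
rewrite -mulr_sumr pmulr_rlt0// sumrB sumr_const card_ord -[P *+ m]mulr_natl subr_lt0.
move=> /ltW; apply: le_trans; apply: ler_sum => t _.
by rewrite /ev_v /= sum_delta.
Qed.

Lemma passes_eq r u y y' : (forall t, (t < m)%N -> y t = y' t) ->
  passes r u y = passes r u y'.
Proof.
move=> yy; apply: eq_forallb => S; congr (_ ==> (_ < _)).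
by apply: eq_bigr => t _; rewrite yy.
Qed.

Lemma decode_eq r own y y' : (forall t, (t < m)%N -> y t = y' t) ->
  decode r own y = decode r own y'.
Proof.
by move=> yy; rewrite /decode; congr odflt; apply: eq_pick => u /=; rewrite (passes_eq _ _ yy).
Qed.

Lemma sg_differ r u u' t :
  sg r finset.setT u t - sg r finset.setT u' t =
  sg r (differ u u') u t - sg r (differ u u') u' t.
Proof.
rewrite /sg /sigl; case: r => [j|] //.
rewrite -!sumrB (bigID [in differ u u'])/=.
rewrite [X in _ + X]big1 ?addr0; last first.
  by move=> a /andP[_]; rewrite inE negbK => /eqP E; rewrite /lab E subrr.
by apply: eq_bigl => a; rewrite finset.in_setT.
Qed.

Let sum_delta_m : m%:R * delta = \sum_(t < m) delta.
Proof. by rewrite sumr_const card_ord mulr_natl. Qed.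

Hypothesis s0 : 0 < s.

Lemma good_passes r u z : good u z ->
  passes r u (fun t => sg r finset.setT u t + z r t).
Proof.
move=> gd; apply/forallP => S; apply/implyP => S0.
have := gd (inl (inl (r, S))) S0; rewrite /ev_exp /=.
have V0 : 0 < outvar r S by apply: lt_le_trans (outvar_ge1 r S).
have Vn : outvar r S != 0 by rewrite gt_eqF.
set V := outvar r S in V0 Vn *.
rewrite (_ : \sum_(t < m) _ = - s * (metric r S u (fun t => sg r finset.setT u t + z r t) + m%:R * delta)).
  by rewrite mulNr oppr_lt0 pmulr_rgt0// => H; rewrite -subr_gt0 opprK.
rewrite sum_delta_m /metric -big_split [RHS]mulr_sumr/=.
apply: eq_bigr => t _; rewrite -/V.
have -> : ev_v u (inl (inl (r, S))) t = sg r S u t by rewrite /ev_v /= sum_coef.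
by field.
Qed.

(** The single test for [differ u u'] refutes [u']: the codewords shared with [u] cancel there, and
    the metric plus m delta is exactly the exponent of the competitor event. *)
Lemma good_fails r u u' z : good u z -> u' != u -> knows r u u' ->
  ~~ passes r u' (fun t => sg r finset.setT u t + z r t).
Proof.
move=> gd uu' kn; apply/forallPn; exists (differ u u').
rewrite negb_imply differ_neq0//= -leNgt.
have v : ev_valid u (inl (inr (r, u'))) by rewrite /= uu' kn.
have := gd _ v; rewrite /ev_exp /=.
rewrite uu' kn /=.
set S := differ u u'.
have V0 : 0 < outvar r S by apply: lt_le_trans (outvar_ge1 r S).
have Vn : outvar r S != 0 by rewrite gt_eqF.
set V := outvar r S in V0 Vn *.
rewrite (_ : \sum_(t < m) _ = metric r S u' (fun t => sg r finset.setT u t + z r t) + m%:R * delta).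
  by move=> /ltW H; rewrite -subr_le0 opprK.
rewrite sum_delta_m /metric -big_split/=.
apply: eq_bigr => t _; rewrite -/V.
have -> : ev_v u (inl (inr (r, u'))) t = sg r S u t.
  by rewrite /ev_v /= uu' kn; under eq_bigr do rewrite mul1r; rewrite sum_coef.
have -> : ev_v' u (inl (inr (r, u'))) t = sg r S u' t.
  by rewrite /ev_v' /= uu' kn; under eq_bigr do rewrite mul1r; rewrite sum_coef.
have D := sg_differ r u u' t; rewrite -/S in D.
rewrite (_ : sg r finset.setT u t + z r t - sg r finset.setT u' t = z r t + sg r S u t - sg r S u' t).
  by field.
by rewrite addrAC D; ring.
Qed.

Lemma good_decode r (own : pred subs) u z : good u z -> own u ->
  (forall u', own u' -> knows r u u') ->
  decode r own (fun t => sg r finset.setT u t + z r t) = u.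
Proof.
move=> gd ou kn; rewrite /decode; case: pickP => [v /andP[ov pv]|/(_ u)] /=; last first.
  by rewrite ou good_passes.
apply/eqP; apply: contraLR pv => vu; apply: good_fails => //; exact: kn.
Qed.

End Decoding.

(** * The block Markov code *)

Lemma eq_digits (K nb i i' : nat) : (0 < K)%N -> (i < K ^ nb)%N -> (i' < K ^ nb)%N ->
  (forall b, (b < nb)%N -> ((i %/ K ^ b) %% K = (i' %/ K ^ b) %% K)%N) -> i = i'.
Proof.
move=> K0; elim: nb i i' => [|nb IH] i i'; first by rewrite expn0 !ltnS !leqn0 => /eqP-> /eqP->.
rewrite expnSr => iK iK' D.
rewrite (divn_eq i K) (divn_eq i' K); congr (_ * _ + _); last first.
  by have := D 0%N isT; rewrite expn0 !divn1.
apply: IH; rewrite ?ltn_divLR// => b bn.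
by rewrite -!divnMA -expnS; exact: D.
Qed.

Lemma nth_tup {R : realType} i (y : nat -> R) k : (k < i)%N -> nth 0 (tup i y) k = y k.
Proof. by move=> ki; rewrite /tup (nth_mktuple _ _ (Ordinal ki)). Qed.

Section Run.
Context {R : realType} (n : nat) (M : 'I_3 * 'I_3 -> nat).
Variables (c : @Defs.code R n M) (h : 'I_3 -> R) (w : msgs M) (z : nat -> R).

Lemma histE i a t : (t < i)%N -> hist c h w z i a t =
  match a with
  | None => \sum_(j < 3) h j * xuser c h w z j t + z (4 * t + 3)%N
  | Some j => h j * xrelay c h w z t + z (4 * t + j)%N
  end.
Proof.
elim: i => // i IH; rewrite ltnS leq_eqVlt => /orP[/eqP ->|ti] /=.
  by rewrite ltnn eqxx.
by rewrite ti IH.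
Qed.

Lemma hist_tup i i' a k : (k < i)%N -> (k < i')%N ->
  nth 0 (tup i (hist c h w z i a)) k = hist c h w z i' a k.
Proof. by move=> ki ki'; rewrite nth_tup// !histE. Qed.

End Run.

Section BlockMarkov.
Context {R : realType}.
Variables (kk : 'I_3 -> nat) (h : 'I_3 -> R) (sp s delta tau P : R) (m nb : nat).
Variable X : nat -> label kk -> R.
Local Notation decode := (decode h sp delta m X).
Local Notation cw := (cw sp P m X).
Local Notation good := (good h sp s delta tau P m X).

(* Messages flow along the cycle 1 -> 2 -> 3 -> 1. *)
Local Notation nx := (@ordS 3).

Definition dig (j : 'I_3) (b i : nat) : 'I_(kk j).+1 :=
  inord ((i %/ (kk j).+1 ^ b) %% (kk j).+1)%N.

Variables (n : nat) (M : 'I_3 * 'I_3 -> nat) (M0 : forall p, (0 < M p)%N).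

Definition subw (w : msgs M) (b : nat) : subs kk := [ffun j => dig j b (w (j, nx j))].

(* In block b the users send the b-th digits of their messages; the relay
   decodes them at the end of block b and forwards them in block b + 1. *)
Definition bm_code : @Defs.code R n M := @Code R n M
  (fun j t mj _ => if (t < m * nb)%N
     then cw (t %% m)%N (inl (Tagged (fun j => 'I_(kk j).+1) (dig j (t %/ m)%N (mj (nx j)))))
     else 0)
  (fun t y => if (m <= t < m * nb.+1)%N
     then cw (t %% m)%N
            (inr (decode None xpredT (fun i => nth 0 y ((t %/ m).-1 * m + i)%N)))
     else 0)
  (fun j mj y k => odflt (Ordinal (M0 (k, j)))
     [pick v : 'I_(M (k, j)) | (nx k == j) ==> [forall b : 'I_nb,
        dig k b v == decode (Some j) (fun u => u j == dig j b (mj (nx j)))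
                       (fun i => nth 0 y (b.+1 * m + i)%N) k]]).

(** The triple of block b reaches the relay in block b and the users in block b + 1, whence the
    shift in the user noise. *)
Definition block_noise (z : nat -> R) (b : nat) (r : option 'I_3) (i : nat) : R :=
  if r is Some j then z (4 * (b.+1 * m + i) + j)%N else z (4 * (b * m + i) + 3)%N.

Section run.
Variables (w : msgs M) (z : nat -> R).

Definition relay_word (b : nat) : subs kk :=
  decode None xpredT (fun i => hist bm_code h w z (b * m + i).+1 None (b * m + i)%N).

Lemma xuser_bm j t : (t < m * nb)%N ->
  xuser bm_code h w z j t = cw (t %% m)%N (lab (subw w (t %/ m)%N) (Some j)).
Proof. by move=> tm; rewrite /xuser /= tm /subw ffunE. Qed.

Lemma xuser_bm0 j t : (m * nb <= t)%N -> xuser bm_code h w z j t = 0.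
Proof. by move=> tm; rewrite /xuser /= ltnNge tm. Qed.

Lemma xrelay_bm t : (m <= t < m * nb.+1)%N ->
  xrelay bm_code h w z t = cw (t %% m)%N (lab (relay_word (t %/ m)%N.-1) None).
Proof.
move=> /andP[mt tm]; rewrite /xrelay /= mt tm /=; congr (cw _ (inr _)).
have m0 : (0 < m)%N by case: (m) tm => //; rewrite mul0n ltn0.
have d0 : (0 < t %/ m)%N by rewrite divn_gt0.
apply: decode_eq => i im; have lt : ((t %/ m).-1 * m + i < t)%N.
  apply: leq_trans (leq_trunc_div t m).
  by rewrite -[in X in (_ < X)%N](prednK d0) mulSn addnC ltn_add2r.
exact: hist_tup.
Qed.

Lemma xrelay_bm0 t : ~~ (m <= t < m * nb.+1)%N -> xrelay bm_code h w z t = 0.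
Proof. by move=> /negbTE tm; rewrite /xrelay /= tm. Qed.

Hypotheses (s0 : 0 < s) (tau0 : 0 < tau).
Hypothesis mn : (m * nb.+1 <= n)%N.
Hypothesis MK : forall j, (M (j, nx j) <= (kk j).+1 ^ nb)%N.
Hypothesis M1 : forall j k, k != nx j -> (M (j, k) <= 1)%N.
Hypothesis gd : forall b, (b < nb)%N -> good (subw w b) (block_noise z b).

Let blockD b i : (i < m)%N -> ((b * m + i) %/ m)%N = b.
Proof. by move=> im; rewrite divnMDl ?(leq_ltn_trans _ im)// divn_small// addn0. Qed.

Let blockM b i : (i < m)%N -> ((b * m + i) %% m)%N = i.
Proof. by move=> im; rewrite modnMDl modn_small. Qed.

Let block_lt b b' i : (b < b')%N -> (i < m)%N -> (b * m + i < m * b')%N.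
Proof.
move=> bb im; apply: (@leq_trans (b.+1 * m)).
  by rewrite mulSn addnC ltn_add2r.
by rewrite mulnC leq_mul2l bb orbT.
Qed.

Let cw_good b a i : (b < nb)%N -> cw i (lab (subw w b) a) = sp * X i (lab (subw w b) a).
Proof. by move=> bn; rewrite /cw (good_fits _ tau0 (gd bn)). Qed.

Let relay_word_good b : (b < nb)%N -> relay_word b = subw w b.
Proof.
move=> bn; rewrite /relay_word.
rewrite -[RHS](@good_decode _ _ h sp s delta tau P m X s0 None xpredT _ _ (gd bn) isT)//.
apply: decode_eq => i im; rewrite histE//; congr (_ + _).
rewrite /sg /sigl; apply: eq_big => [j|j _]; first by rewrite finset.in_setT.
rewrite xuser_bm ?block_lt// blockD// blockM// (cw_good (Some j))//.
by rewrite mulrCA mulrA.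
Qed.

Let user_decode_good b j : (b < nb)%N ->
  decode (Some j) (fun u => u j == dig j b (w (j, nx j)))
    (fun i => nth 0 (tup n (hist bm_code h w z n (Some j))) (b.+1 * m + i)%N) = subw w b.
Proof.
move=> bn; have own : subw w b j == dig j b (w (j, nx j)) by rewrite ffunE.
rewrite -[RHS](@good_decode _ _ h sp s delta tau P m X s0 (Some j)
  (fun u => u j == dig j b (w (j, nx j))) _ _ (gd bn) own); last first.
  by move=> u' /eqP E; rewrite /knows E ffunE.
apply: decode_eq => i im.
have lt : (b.+1 * m + i < m * nb.+1)%N by exact: block_lt.
rewrite nth_tup ?(leq_trans lt)// histE ?(leq_trans lt)//; congr (_ + _).
rewrite xrelay_bm; last by rewrite lt mulSn -addnA leq_addr.
rewrite blockD// blockM//= relay_word_good// (cw_good None)// /sg /sigl.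
by rewrite mulrCA mulrA.
Qed.

Lemma bm_code_correct : err bm_code h w z = false.
Proof.
apply/negbTE/fintype.existsPn => j; apply/fintype.existsPn => k.
apply/negP => /andP[kj /negP]; apply; apply/eqP => /=.
case: pickP => [v|] /=; last first.
  move=> /(_ (w (k, j))); case: eqP => //= nkj; subst j; case/negP.
  apply/fintype.forallP => b; by rewrite user_decode_good// ffunE.
case: eqP => /= [nkj|/eqP nkj] H; last first.
  (* Off the cycle there is a single message, so any estimate is right. *)
  have M1' : (M (k, j) <= 1)%N by apply: M1; rewrite eq_sym.
  have ord1 (x : 'I_(M (k, j))) : (x : nat) = 0%N.
    by have := leq_trans (ltn_ord x) M1'; rewrite ltnS leqn0 => /eqP.
  by apply: val_inj; rewrite /= !ord1.
subst j; apply: val_inj; apply: (@eq_digits (kk k).+1 nb) => //.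
- by apply: leq_trans (ltn_ord v) _; exact: MK.
- by apply: leq_trans (ltn_ord _) _; exact: MK.
move=> b bn; move/fintype.forallP: H => /(_ (Ordinal bn)); rewrite user_decode_good// ffunE /=.
move=> /eqP/(congr1 val); rewrite /= !inordK//; exact: ltn_pmod.
Qed.

End run.
End BlockMarkov.

(** * Measurability of the code *)

Section FiniteMeasurability.
Context {d : measure_display} {T0 : measurableType d}.

Definition finite_measurable (F : finType) (g : T0 -> F) : Prop :=
  forall x, measurable [set y | g y = x].

Lemma finite_measurable_pred (F : finType) (g : T0 -> F) (Q : F -> Prop) :
  finite_measurable g -> measurable [set y | Q (g y)].
Proof.
move=> mg; rewrite (_ : [set y | _] = \bigcup_(x in [set x | Q x]) [set y | g y = x]).
  by apply: fin_bigcup_measurable => [|x _]; [exact: finite_finset|exact: mg].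
by apply/seteqP; split => [y Qy|y [x Qx yx]] /=; [by exists (g y)|by rewrite yx].
Qed.

Lemma finite_measurable_comp (F F' : finType) (g : T0 -> F) (f : F -> F') :
  finite_measurable g -> finite_measurable (f \o g).
Proof. by move=> mg x; exact: (finite_measurable_pred (fun u => f u = x) mg). Qed.

Lemma finite_measurable_ffun (I F : finType) (g : I -> T0 -> F) :
  (forall i, finite_measurable (g i)) -> finite_measurable (fun y => [ffun i => g i y]).
Proof.
move=> mg f; rewrite (_ : [set y | _] = \bigcap_(i in setT) [set y | g i y = f i]).
  by apply: fin_bigcap_measurable => [|i _]; [exact: finite_finset|exact: mg].
apply/seteqP; split => [y /= <- i _|y fy]; first by rewrite /= ffunE.
by apply/ffunP => i; rewrite ffunE; exact: fy.
Qed.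

Lemma finite_measurable_bool (g : T0 -> bool) :
  measurable_fun setT g -> finite_measurable g.
Proof. by move=> mg x; have := mg measurableT [set x] I; rewrite setTI. Qed.

Lemma finite_measurable_fun {R : realType} (F : finType) (g : T0 -> F) (f : F -> R) :
  finite_measurable g -> measurable_fun setT (f \o g).
Proof.
move=> mg _ Y mY; rewrite setTI; exact: (finite_measurable_pred (fun u => Y (f u)) mg).
Qed.

End FiniteMeasurability.

Lemma measurable_nth {R : realType} i k :
  measurable_fun [set: i.-tuple R] (fun y => nth 0 y k).
Proof.
have [ki|ki] := ltnP k i; last first.
  rewrite (_ : (fun y => _) = fun=> 0); first exact: measurable_cst.
  by apply/funext => y; rewrite nth_default// size_tuple.
rewrite (_ : (fun y => _) = (fun y => tnth y (Ordinal ki))); first exact: measurable_tnth.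
by apply/funext => y; rewrite (tnth_nth 0).
Qed.

Section DecoderMeasurability.
Context {R : realType} {d : measure_display} {T0 : measurableType d}.
Variables (kk : 'I_3 -> nat) (h : 'I_3 -> R) (sp delta : R) (m : nat).
Variable X : nat -> label kk -> R.

(** The decoder factors through the finite table of threshold outcomes, each of which is a
    comparison of a polynomial in the outputs with a constant. *)
Lemma finite_measurable_decode r own (y : T0 -> nat -> R) :
  (forall i, measurable_fun setT (fun v => y v i)) ->
  finite_measurable (fun v => decode h sp delta m X r own (y v)).
Proof.
move=> my.
pose G (b : {ffun subs kk -> bool}) : subs kk :=
  odflt [ffun j => ord0] [pick u | own u && b u].
rewrite (_ : (fun v => _) =
    G \o (fun v => [ffun u => passes h sp delta m X r u (y v)])); last first.
  by apply/funext => v; rewrite /decode /G /=; congr odflt; apply: eq_pick => u; rewrite ffunE.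
apply: finite_measurable_comp; apply: finite_measurable_ffun => u.
pose H (b : {ffun {set 'I_3} -> bool}) := [forall A : {set 'I_3}, (A != finset.set0) ==> b A].
rewrite (_ : (fun v => _) = H \o
    (fun v => [ffun A => - (m%:R * delta) < metric h sp m X r A u (y v)])); last first.
  by apply/funext => v; rewrite /H /=; apply: eq_forallb => A; rewrite ffunE.
apply: finite_measurable_comp; apply: finite_measurable_ffun => A.
apply: finite_measurable_bool; apply: measurable_fun_ltr; first exact: measurable_cst.
apply: measurable_sum => t; apply: measurable_funB; apply: measurable_funM => //.
  by apply: measurable_funX; apply: measurable_funD => //; exact: measurable_funB.
by apply: measurable_funX; exact: measurable_funB.
Qed.

End DecoderMeasurability.

Section CodeMeasurability.
Context {R : realType}.
Variables (kk : 'I_3 -> nat) (h : 'I_3 -> R) (sp delta P : R) (m nb : nat).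
Variable X : nat -> label kk -> R.
Variables (n : nat) (M : 'I_3 * 'I_3 -> nat) (M0 : forall p, (0 < M p)%N).

Lemma bm_code_measurable : code_measurable (bm_code h sp delta P m nb X n M0).
Proof.
split => [j i mj|i|j mj v].
- exact: measurable_cst.
- have [E|/negbTE E] := boolP (m <= i < m * nb.+1)%N; last first.
    rewrite (_ : Defs.rel _ (i := i) = fun=> 0); first exact: measurable_cst.
    by apply/funext => y /=; rewrite E.
  pose D (y : i.-tuple R) := decode h sp delta m X None xpredT
     (fun l => nth 0 y ((i %/ m).-1 * m + l)%N).
  rewrite (_ : Defs.rel _ (i := i) = (fun u => cw sp P m X (i %% m)%N (inr u)) \o D); last first.
    by apply/funext => y /=; rewrite E.
  apply: (@finite_measurable_fun _ _ _ _ D (fun u => cw sp P m X (i %% m)%N (inr u))).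
  by apply: finite_measurable_decode => l; exact: measurable_nth.
pose D (b : 'I_nb) (y : n.-tuple R) := decode h sp delta m X (Some j)
   (fun u => u j == dig kk j b (mj (ordS j))) (fun i => nth 0 y (b.+1 * m + i)%N).
pose G (f : {ffun 'I_nb -> subs kk}) (k : 'I_3) : 'I_(M (k, j)) :=
  odflt (Ordinal (M0 (k, j))) [pick v : 'I_(M (k, j)) |
     (ordS k == j) ==> [forall b : 'I_nb, dig kk k b v == f b k]].
rewrite (_ : [set y | _] = [set y | G [ffun b => D b y] = v]).
  apply: (finite_measurable_pred (fun f => G f = v)).
  apply: finite_measurable_ffun => b.
  by apply: finite_measurable_decode => l; exact: measurable_nth.
apply/seteqP; split => y /= <-; apply: functional_extensionality_dep => k;
  congr odflt; apply: eq_pick => x; congr (_ ==> _); apply: eq_forallb => b;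
  by rewrite ffunE.
Qed.

End CodeMeasurability.

(** * Averages and the power constraint *)

Section Averages.
Context {R : realType} (n : nat) (M : 'I_3 * 'I_3 -> nat) (M0 : forall p, (0 < M p)%N).

Lemma card_msgs_gt0 : (0 < #|msgs M|)%N.
Proof. by apply/card_gt0P; exists [ffun p => Ordinal (M0 p)]. Qed.

(** A bound on the total for every message and noise sample bounds the sum of averages, by
    superadditivity. *)
Lemma sum_Eavg_le (I : Type) (r : seq I) (F : I -> msgs M -> (nat -> R) -> \bar R) (C : R) :
  (forall i w z, 0 <= F i w z)%E -> (forall w z, \sum_(i <- r) F i w z <= C%:E)%E ->
  (\sum_(i <- r) Eavg n (F i) <= C%:E)%E.
Proof.
move=> F0 FC; rewrite /Eavg -ge0_sume_distrr; last first.
  by move=> i _; apply: sume_ge0 => w _; apply: Gexp_ge0.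
rewrite exchange_big /=.
have n0 : (0 : R) < #|msgs M|%:R by rewrite ltr0n card_msgs_gt0.
rewrite lee_pdivrMl// -EFinM.
apply: (@le_trans _ _ (\sum_(w : msgs M) C%:E)%E).
  apply: lee_sum => w _; apply: le_trans (Gexp_super_sum _ _ _) _ => //.
  rewrite -[leRHS](Gexp_cst (4 * n)); apply: le_Gexp => z; last exact: FC.
  exact: sume_ge0.
rewrite sumEFin lee_fin sumr_const mulr_natl.
exact: lexx.
Qed.

Lemma Eavg_le (F G : msgs M -> (nat -> R) -> \bar R) :
  (forall w z, 0 <= F w z)%E -> (forall w z, F w z <= G w z)%E -> (Eavg n F <= Eavg n G)%E.
Proof.
move=> F0 FG; apply: lee_wpmul2l; first by rewrite lee_fin invr_ge0.
by apply: lee_sum => w _; apply: le_Gexp.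
Qed.

End Averages.

Section Power.
Context {R : realType}.
Variables (kk : 'I_3 -> nat) (h : 'I_3 -> R) (sp delta P : R) (m nb : nat).
Variable X : nat -> label kk -> R.
Variables (n : nat) (M : 'I_3 * 'I_3 -> nat) (M0 : forall p, (0 < M p)%N).
Hypotheses (P0 : 0 <= P) (mn : (m * nb.+1 <= n)%N).

Lemma sum_blocks (N : nat) (g : nat -> R) : (m * N <= n)%N ->
  (forall t, (m * N <= t)%N -> g t = 0) ->
  (forall b, (b < N)%N -> \sum_(i < m) g (b * m + i)%N <= m%:R * P) ->
  \sum_(t < n) g t <= n%:R * P.
Proof.
move=> mNn g0 gb; rewrite -(big_mkord xpredT) (big_cat_nat (leq0n _) mNn)/=.
rewrite [X in _ + X]big_nat [X in _ + X]big1 ?addr0; last by move=> t /andP[/g0].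
apply: (@le_trans _ _ ((m * N)%:R * P)); last by rewrite ler_wpM2r// ler_nat.
elim: N {mNn g0} gb => [|N IH] gb; first by rewrite muln0 big_geq// mul0r.
rewrite mulnS addnC (big_cat_nat (leq0n _) (leq_addr m _))/= natrD mulrDl lerD//.
  by apply: IH => b bN; apply: gb; rewrite (leq_trans bN).
have := gb N (ltnSn N); rewrite -(big_mkord xpredT (fun i => g (N * m + i)%N)).
rewrite -{1}[(m * N)%N]add0n big_addn addKn => H; apply: le_trans H.
by rewrite le_eqVlt; apply/orP; left; apply/eqP/eq_bigr => i _; rewrite mulnC addnC.
Qed.

Lemma cw_power l : \sum_(t < m) cw sp P m X t l ^+ 2 <= m%:R * P.
Proof.
rewrite /cw; have [f|_] := boolP (fits sp P m X l).
  exact: f.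
by rewrite big1 ?mulr_ge0// => t _; rewrite expr0n.
Qed.

Lemma bm_code_power : power_ok (bm_code h sp delta P m nb X n M0) h P.
Proof.
have blockD b i : (i < m)%N -> ((b * m + i) %/ m)%N = b.
  by move=> im; rewrite divnMDl ?(leq_ltn_trans _ im)// divn_small// addn0.
have blockM b i : (i < m)%N -> ((b * m + i) %% m)%N = i.
  by move=> im; rewrite modnMDl modn_small.
have block_lt b b' i : (b < b')%N -> (i < m)%N -> (b * m + i < m * b')%N.
  move=> bb im; apply: (@leq_trans (b.+1 * m)).
    by rewrite mulSn addnC ltn_add2r.
  by rewrite mulnC leq_mul2l bb orbT.
split=> [j|]; (apply: sum_Eavg_le => // [t w z|w z]; first by rewrite lee_fin sqr_ge0);
  rewrite sumEFin lee_fin.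
  apply: (@sum_blocks nb (fun t => xuser _ h w z j t ^+ 2)).
  - by apply: leq_trans mn; rewrite leq_mul2l leqnSn orbT.
  - by move=> t tm; rewrite xuser_bm0// expr0n.
  move=> b bn; apply: le_trans (cw_power (lab (subw kk w b) (Some j))).
  apply: ler_sum => i _.
  by rewrite xuser_bm ?block_lt// blockD// blockM.
apply: (@sum_blocks nb.+1 (fun t => xrelay _ h w z t ^+ 2)) => //.
- by move=> t tm; rewrite xrelay_bm0 ?expr0n// negb_and -!ltnNge ltnS tm orbT.
(* In block 0 the relay has nothing to forward and is silent. *)
case=> [|b] bn.
  rewrite big1 ?mulr_ge0// => i _; rewrite mul0n add0n xrelay_bm0 ?expr0n//.
  by rewrite negb_and -ltnNge ltn_ord.
apply: le_trans (cw_power (lab (relay_word h sp delta P m nb X n M0 w z b) None)).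
apply: ler_sum => i _.
rewrite xrelay_bm; last by rewrite block_lt// andbT mulSn -addnA leq_addr.
by rewrite blockD// blockM.
Qed.

End Power.

Section ErrorBound.
Context {R : realType}.

(** An event sees only m of the N noise samples. Its coefficients are extended by zero to all
    samples, and each unseen sample contributes a factor one. *)
Lemma Gexp_sum_expR_quad_inj N m (I : Type) (r : seq I) (w : I -> R)
    (a b c : I -> 'I_m -> R) (idx : I -> 'I_m -> nat) :
  (forall i, 0 <= w i) -> (forall i t, 2 * a i t < 1) ->
  (forall i t, (idx i t < N)%N) -> (forall i, injective (idx i)) ->
  Gexp N (fun s => (\sum_(i <- r) w i *
    expR (\sum_(t < m) (a i t * s (idx i t) ^+ 2 + b i t * s (idx i t) + c i t)))%:E) =
  (\sum_(i <- r) w i * \prod_(t < m) ((Num.sqrt (1 - 2 * a i t))^-1 *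
      expR (c i t + b i t ^+ 2 / (2 * (1 - 2 * a i t)))))%:E.
Proof.
move=> w0 a1 iN inj.
pose D (f : I -> 'I_m -> R) i (k : nat) := \sum_(t < m | idx i t == k) f i t.
have DE f i t : D f i (idx i t) = f i t.
  rewrite /D (big_pred1 t)// => t' /=; apply/eqP/eqP => [/inj//|->//].
have D0 f i k : (forall t, idx i t != k) -> D f i k = 0.
  by move=> ik; rewrite /D big1// => t /eqP E; have := ik t; rewrite E eqxx.
have Da i k : 2 * D a i k < 1.
  have [/existsP[t /eqP <-]|/existsPn ik] := boolP [exists t, idx i t == k].
    by rewrite DE.
  by rewrite D0 ?mulr0.
have Dsum i (g : R -> nat -> R) (f : I -> 'I_m -> R) : (forall k, g 0 k = 0) -> 
    \sum_(k < N) g (D f i k) k = \sum_(t < m) g (f i t) (idx i t).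
  move=> g0; pose J t : 'I_N := Ordinal (iN i t).
  have Jinj : injective J by move=> t t' /(congr1 val)/inj.
  rewrite (bigID [in [set J t | t : 'I_m]%SET])/= [X in _ + X]big1 ?addr0.
    rewrite big_imset/=; last by move=> t t' _ _; exact: Jinj.
    by apply: eq_bigr => t _; rewrite DE.
  move=> k kJ; rewrite D0// => t; apply: contra kJ => /eqP E.
  by apply/imsetP; exists t => //; apply: val_inj.
transitivity (Gexp N (fun s => (\sum_(i <- r) w i *
    expR (\sum_(k < N) (D a i k * s k ^+ 2 + D b i k * s k + D c i k)))%:E)).
  congr (Gexp _ _); apply/funext => s; congr EFin; apply: eq_bigr => i _.
  congr (_ * expR _); rewrite !big_split/=.
  rewrite (Dsum i (fun x k => x * s k ^+ 2)) ?(Dsum i (fun x k => x * s k))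
     ?(Dsum i (fun x k => x))// => k; exact: mul0r.
rewrite Gexp_sum_expR_quad//; congr EFin; apply: eq_bigr => i _; congr (_ * _).
pose J t : 'I_N := Ordinal (iN i t).
have Jinj : injective J by move=> t t' /(congr1 val)/inj.
rewrite (bigID [in [set J t | t : 'I_m]%SET])/= [X in _ * X]big1 ?mulr1.
  rewrite big_imset/=; last by move=> t t' _ _; exact: Jinj.
  by apply: eq_bigr => t _; rewrite !DE.
move=> k kJ; have ik t : idx i t != k.
  apply: contra kJ => /eqP E; apply/imsetP; exists t => //; exact: val_inj.
by rewrite !D0// mulr0 subr0 sqrtr1 expr0n/= mul0r add0r expR0 invr1 mulr1.
Qed.

End ErrorBound.

(** * Error probability *)

Section RandomCoding.
Context {R : realType}.
Variables (kk : 'I_3 -> nat) (h : 'I_3 -> R) (sp s delta tau P : R) (m nb : nat).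
Variables (n : nat) (M : 'I_3 * 'I_3 -> nat) (M0 : forall p, (0 < M p)%N).
Hypotheses (s0 : 0 < s) (s1 : s < 1) (tau0 : 0 < tau).
Hypothesis mn : (m * nb.+1 <= n)%N.
Hypothesis MK : forall j, (M (j, ordS j) <= (kk j).+1 ^ nb)%N.
Hypothesis M1 : forall j k : 'I_3, k != ordS j -> (M (j, k) <= 1)%N.

Local Notation event := (event kk).

Definition ev_letter (u : subs kk) (e : event) (x : label kk -> R) : R :=
  kind_A s delta tau P (ev_kind h sp u e) *
  expR (qform (kind_p s tau (ev_kind h sp u e)) (kind_q (ev_kind h sp u e))
    (kind_r (ev_kind h sp u e)) (\sum_l ev_coef h sp u e l * x l)
    (\sum_l ev_coef' h sp u e l * x l)).

(* Expected number of blocks carrying [u].  The codebook is selected for this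
   actual law of the sub-messages, which need not be uniform. *)
Definition weight (u : subs kk) : R :=
  #|msgs M|%:R^-1 * \sum_(w : msgs M) \sum_(b < nb) (subw kk w b == u)%:R.

Lemma weight_ge0 u : 0 <= weight u.
Proof.
rewrite mulr_ge0 ?invr_ge0//; apply: sumr_ge0 => w _; apply: sumr_ge0 => b _.
by rewrite ler0n.
Qed.

Lemma sum_weight : \sum_u weight u = nb%:R.
Proof.
rewrite -mulr_sumr exchange_big/=.
under eq_bigr => w _.
  rewrite exchange_big/=; under eq_bigr => b _.
    rewrite (bigD1 (subw kk w b))//= eqxx big1 ?addr0; last first.
      by move=> u /negbTE E; rewrite eq_sym E.
    over.
  rewrite sumr_const card_ord; over.
rewrite sumr_const -[X in _ * X]mulr_natl mulrA mulVf ?mul1r//.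
by rewrite pnatr_eq0 -lt0n card_msgs_gt0.
Qed.

Definition noise_idx (b : nat) (e : event) (i : nat) : nat :=
  if ev_node e is Some j then (4 * (b.+1 * m + i) + j)%N else (4 * (b * m + i) + 3)%N.

Lemma noise_idxE (z : nat -> R) b (e : event) i : block_noise m z b (ev_node e) i = z (noise_idx b e i).
Proof. by rewrite /block_noise /noise_idx; case: (ev_node e). Qed.

(** Union bound over blocks and events, followed by exact integration of the noise; what remains
    depends on the codebook only and factorizes over its letters. *)
Lemma err_prob_le X :
  (err_prob (bm_code h sp delta P m nb X n M0) h <=
   (\sum_(p : subs kk * event) weight p.1 * (ev_valid p.1 p.2)%:R *
      \prod_(t < m) ev_letter p.1 p.2 (X t))%:E)%E.
Proof.
pose F (w : msgs M) (p : 'I_nb * event) (z : nat -> R) : R :=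
  (ev_valid (subw kk w p.1) p.2)%:R *
  expR (ev_exp h sp s delta tau P m X (subw kk w p.1) p.2
     (fun i => z (noise_idx p.1 p.2 i))).
have F0 w p z : 0 <= F w p z by rewrite mulr_ge0 ?expR_ge0.
pose E (w : msgs M) (z : nat -> R) : \bar R := (\sum_p F w p z)%:E.
apply: (@le_trans _ _ (Eavg n E)).
  apply: Eavg_le => w z; first by rewrite lee_fin.
  rewrite lee_fin.
  have S0 : 0 <= \sum_p F w p z by exact: sumr_ge0.
  (* Either some block is bad and its exponentials already sum to at least one, or all blocks are
     good and decoding is correct. *)
  have [/fintype.existsP[b ngd]|/fintype.existsPn gd] := boolP
    [exists b : 'I_nb, ~~ `[< good h sp s delta tau P m X (subw kk w b) (block_noise m z b) >]].
    apply: (@le_trans _ _ 1); first by rewrite lern1; case: err.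
    have := good_indicator h sp s delta tau P m X (subw kk w b) (block_noise m z b).
    rewrite ngd => /le_trans; apply.
    rewrite /F -(pair_bigA _ (fun b e => F w (b, e) z))/= (bigD1 b)//=.
    rewrite ler_wpDr//.
      by apply: sumr_ge0 => b' _; apply: sumr_ge0 => e _; exact: (F0 w (b', e)).
    rewrite big_mkcond/= le_eqVlt; apply/orP; left; apply/eqP/eq_bigr => e _.
    rewrite /F /=; case: ifP => _; rewrite ?mul0r// mul1r; congr expR.
    by apply: eq_bigr => i _; rewrite noise_idxE.
  rewrite (@bm_code_correct _ kk h sp s delta tau)// => b bn.
  by have := gd (Ordinal bn); rewrite negbK => /asboolP.
have idx_lt (p : 'I_nb * event) (t : 'I_m) : (noise_idx p.1 p.2 t < 4 * n)%N.
  have bm : (p.1.+1 * m <= m * nb)%N by rewrite mulnC leq_mul2l ltn_ord orbT.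
  have bm' : (p.1 * m <= p.1.+1 * m)%N by rewrite leq_mul2r leqnSn orbT.
  have := ltn_ord t; move: mn bm bm'; rewrite mulnS /noise_idx.
  case: (ev_node p.2) => [j|]; last by lia.
  by have := ltn_ord j; lia.
have idx_inj (p : 'I_nb * event) : injective (fun t : 'I_m => noise_idx p.1 p.2 t).
  move=> t t'; rewrite /noise_idx => E'; apply: val_inj => /=.
  by case: (ev_node p.2) E' => [j|]; lia.
rewrite /Eavg; under eq_bigr => w _.
  rewrite (@Gexp_sum_expR_quad_inj R (4 * n) m _ (index_enum _)
    (fun p : 'I_nb * event => (ev_valid (subw kk w p.1) p.2)%:R)
    (fun p t => kind_a s (ev_kind h sp (subw kk w p.1) p.2))
    (fun p t => kind_b s (ev_kind h sp (subw kk w p.1) p.2)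
       (ev_v h sp X (subw kk w p.1) p.2 t) (ev_v' h sp X (subw kk w p.1) p.2 t))
    (fun p t => kind_k s delta tau P (ev_kind h sp (subw kk w p.1) p.2)
       (ev_v h sp X (subw kk w p.1) p.2 t) (ev_v' h sp X (subw kk w p.1) p.2 t))
    (fun p t => noise_idx p.1 p.2 t)) //; last first.
    by move=> p t; apply: kind_a_lt1 => //; exact: ev_kind_ok.
  under eq_bigr => p _.
    under eq_bigr => t _ do rewrite kind_mean ?ev_kind_ok//.
    over.
  over.
rewrite sumEFin -EFinM lee_fin le_eqVlt; apply/orP; left; apply/eqP.
pose H u e : R := (ev_valid u e)%:R * \prod_(t < m) ev_letter u e (X t).
transitivity (#|msgs M|%:R^-1 * \sum_(w : msgs M) \sum_(b < nb) \sum_e H (subw kk w b) e).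
  congr (_ * _); apply: eq_bigr => w _.
  by rewrite (pair_bigA _ (fun (b : 'I_nb) e => H (subw kk w b) e)).
transitivity (\sum_u \sum_e weight u * H u e); last first.
  rewrite pair_bigA; apply: eq_bigr => -[u e] _ /=.
  by rewrite /H mulrA.
under [RHS]eq_bigr do rewrite -mulr_sumr /weight -mulrA.
rewrite -mulr_sumr; congr (_ * _).
under [RHS]eq_bigr do rewrite mulr_suml.
rewrite [RHS]exchange_big/=; apply: eq_bigr => w _.
under [RHS]eq_bigr do rewrite mulr_suml.
rewrite [RHS]exchange_big/=; apply: eq_bigr => b _.
rewrite [RHS](bigD1 (subw kk w b))//= eqxx mul1r [X in _ + X]big1 ?addr0//.
by move=> u /negbTE uE; rewrite eq_sym uE mul0r.
Qed.

End RandomCoding.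

Section Existence.
Context {R : realType}.
Variables (kk : 'I_3 -> nat) (h : 'I_3 -> R) (sp s delta tau P : R) (m nb : nat).
Variables (n : nat) (M : 'I_3 * 'I_3 -> nat) (M0 : forall p, (0 < M p)%N).
Variables (B1 B3 T : R).
Hypotheses (s0 : 0 < s) (s1 : s < 1) (tau0 : 0 < tau) (delta0 : 0 < delta).
Hypothesis mn : (m * nb.+1 <= n)%N.
Hypothesis MK : forall j, (M (j, ordS j) <= (kk j).+1 ^ nb)%N.
Hypothesis M1 : forall j k : 'I_3, k != ordS j -> (M (j, k) <= 1)%N.
Hypothesis failB : (Num.sqrt (1 - s ^+ 2))^-1 * expR (- s * delta) < B1.
Hypothesis pow0 : 0 < 1 - sp ^+ 2 * (2 * tau).
Hypothesis powB : expR (- tau * P) * (Num.sqrt (1 - sp ^+ 2 * (2 * tau)))^-1 < B3.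
Hypothesis T0 : 0 <= T.
Hypothesis compB : forall r (A : {set 'I_3}), A != finset.set0 ->
  (if r is Some j then j \notin A else true) ->
  (\prod_(a in A) (kk a).+1)%:R *
    ((Num.sqrt (outvar h sp r A))^-1 * expR (2 * delta)) ^+ m <= T.

Local Notation event := (event kk).

(** The competitor mean carries exp(delta); doubling delta here gives the strict inequality that the
    codebook selection requires. *)
Definition kind_B (e : kind) : R :=
  match e with
  | Fail _ => B1
  | Comp V => (Num.sqrt V)^-1 * expR (2 * delta)
  | Pow => B3
  end.

Let B10 : 0 <= B1.
Proof. by apply: ltW; apply: le_lt_trans failB; rewrite mulr_ge0 ?expR_ge0// invr_ge0 sqrtr_ge0. Qed.

Let B30 : 0 <= B3.
Proof. by apply: ltW; apply: le_lt_trans powB; rewrite mulr_ge0 ?expR_ge0// invr_ge0 sqrtr_ge0. Qed.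

Let kind_S (e : kind) : R := match e with Fail V | Comp V => V - 1 | Pow => sp ^+ 2 end.
Let kind_S' (e : kind) : R := match e with Comp V => V - 1 | _ => 0 end.

Let kind_A0 e : 0 <= kind_A s delta tau P e.
Proof.
by case: e => [V|V|] /=; rewrite ?mulr_ge0 ?expR_ge0// invr_ge0 sqrtr_ge0.
Qed.

Let qdet_r0 (p x : R) : qdet p 0 0 x 0 = 1 - x * p.
Proof. by rewrite /qdet !mulr0 mul0r !subr0 mulr1. Qed.

Let kind_det (e : kind) : kind_ok e ->
  let p := kind_p s tau e in let q := kind_q e in let r := kind_r e in
  [/\ 0 < 1 - kind_S e * p, 0 < 1 - kind_S' e * r, 0 < qdet p q r (kind_S e) (kind_S' e) &
   kind_A s delta tau P e * (Num.sqrt (qdet p q r (kind_S e) (kind_S' e)))^-1 < kind_B e].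
Proof.
case: e => [V|V|] /= V1.
- have [D le] := kind_fail_mean delta tau P s0 s1 V1.
  rewrite mul0r subr0 ltr01 qdet_r0; split => //; exact: le_lt_trans le failB.
- have [D1 D2 D3 E] := kind_comp_mean s delta tau P V1; split => //.
  rewrite [ltLHS]E ltr_pM2l ?ltr_expR ?mulr_natl ?mulr2n ?ltrDl//.
  by rewrite invr_gt0 sqrtr_gt0; apply: lt_le_trans V1.
- by rewrite mul0r subr0 ltr01 qdet_r0.
Qed.

Lemma exists_random_codebook (wt : subs kk * event -> R) : (forall p, 0 <= wt p) ->
  exists X : nat -> label kk -> R,
  \sum_p wt p * \prod_(t < m) ev_letter h sp s delta tau P p.1 p.2 (X t) <=
  \sum_p wt p * kind_B (ev_kind h sp p.1 p.2) ^+ m.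
Proof.
move=> wt0; pose K (p : subs kk * event) := ev_kind h sp p.1 p.2.
have ok p : kind_ok (K p) by exact: ev_kind_ok.
have SE p : \sum_l ev_coef h sp p.1 p.2 l ^+ 2 = kind_S (K p) by exact: sum_ev_coef2.
have SE' p : \sum_l ev_coef' h sp p.1 p.2 l ^+ 2 = kind_S' (K p) by exact: sum_ev_coef'2.
apply: (@exists_codebook R (label kk) (subs kk * event)%type (inr [ffun j => ord0])
  (fun p => kind_A s delta tau P (K p)) (fun p => kind_B (K p))
  (fun p => kind_p s tau (K p)) (fun p => kind_q (K p)) (fun p => kind_r (K p))
  (fun p => ev_coef h sp p.1 p.2) (fun p => ev_coef' h sp p.1 p.2)) => //.
- by move=> p l; exact: ev_coef_orthogonal.
- by move=> p; rewrite SE; have [] := kind_det (ok p).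
- by move=> p; rewrite SE'; have [] := kind_det (ok p).
- by move=> p; rewrite SE SE'; have [] := kind_det (ok p).
- by move=> p; rewrite SE SE'; have [] := kind_det (ok p).
Qed.

Lemma card_differ (u : subs kk) (A : {set 'I_3}) :
  (#|[set u' | differ u u' == A]%SET| <= \prod_(a in A) (kk a).+1)%N.
Proof.
pose F (a : 'I_3) : pred 'I_(kk a).+1 := if a \in A then predT else pred1 (u a).
pose FF : simpl_pred (subs kk) := family F.
have -> : (\prod_(a in A) (kk a).+1 = #|FF|)%N.
  rewrite card_family foldrE big_map big_enum/= big_mkcond/=.
  by apply: eq_bigr => a _; rewrite /F; case: ifP => _; rewrite ?card_ord ?card1.
apply: subset_leq_card; apply/fintype.subsetP => u'; rewrite inE => /eqP E.
apply/familyP => a; rewrite /F; case: ifPn => // aA.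
by move: aA; rewrite -E inE negbK => /eqP ->; rewrite inE.
Qed.

(** The coefficient 32 is 4 nodes times 8 index sets, and 4 counts the codewords of one triple.
    Competitors are grouped by the set where they differ from [u], and each group is bounded by
    [compB]. *)
Lemma sum_events (u : subs kk) :
  \sum_(e : event) (ev_valid u e)%:R * kind_B (ev_kind h sp u e) ^+ m <=
  32 * B1 ^+ m + 32 * T + 4 * B3 ^+ m.
Proof.
have cardS : #|{set 'I_3}| = 8%N by rewrite -cardsT -powersetT card_powerset cardsT card_ord.
have cardo : #|{: option 'I_3}| = 4%N by rewrite card_option card_ord.
rewrite big_sumType big_sumType /= lerD//; last first.
  by rewrite (eq_bigr (fun=> B3 ^+ m)) ?sumr_const ?cardo ?mulr_natl// => a _; rewrite mul1r.
rewrite lerD//.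
  rewrite (eq_bigr (fun p : option 'I_3 * {set 'I_3} => (p.2 != finset.set0)%:R * B1 ^+ m)); last first.
    by case.
  rewrite -(pair_bigA _ (fun (r : option 'I_3) (A : {set 'I_3}) => (A != finset.set0)%:R * B1 ^+ m))/=.
  apply: (@le_trans _ _ (\sum_(r : option 'I_3) \sum_(A : {set 'I_3}) B1 ^+ m)).
    apply: ler_sum => r _; apply: ler_sum => A _.
    by case: (_ != _); rewrite ?mul1r// mul0r exprn_ge0.
  by rewrite !sumr_const cardS cardo -mulrnA mulr_natl.
rewrite (eq_bigr (fun p : option 'I_3 * subs kk => ((p.2 != u) && knows p.1 u p.2)%:R *
    ((Num.sqrt (if (p.2 != u) && knows p.1 u p.2 then outvar h sp p.1 (differ u p.2) else 1))^-1 *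
       expR (2 * delta)) ^+ m)); last by case.
rewrite -(pair_bigA _ (fun (r : option 'I_3) (u' : subs kk) => ((u' != u) && knows r u u')%:R *
    ((Num.sqrt (if (u' != u) && knows r u u' then outvar h sp r (differ u u') else 1))^-1 *
       expR (2 * delta)) ^+ m))/=.
apply: (@le_trans _ _ (\sum_(r : option 'I_3) \sum_(A : {set 'I_3}) T)); last first.
  by rewrite !sumr_const cardS cardo -mulrnA mulr_natl.
apply: ler_sum => r _; rewrite (partition_big (differ u) xpredT)//=.
apply: ler_sum => A _.
pose ok := (A != finset.set0) && (if r is Some j then j \notin A else true).
have okP u' : differ u u' = A -> (u' != u) && knows r u u' = ok.
  move=> E; congr (_ && _).
    apply/idP/idP => [uu'|]; first by rewrite -E differ_neq0.
    apply: contra => /eqP uu'; rewrite -E uu'; apply/eqP/finset.setP => a.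
    by rewrite !inE eqxx.
  by rewrite /knows; case: (r) => //= j; rewrite -E inE negbK eq_sym.
have [okA|nok] := boolP ok; last first.
  by rewrite big1// => u' /eqP/okP ->; rewrite (negbTE nok) mul0r.
rewrite (eq_bigr (fun=> ((Num.sqrt (outvar h sp r A))^-1 * expR (2 * delta)) ^+ m)); last first.
  by move=> u' /eqP E; rewrite (okP _ E) okA mul1r E.
have /andP[A0 rA] := okA.
rewrite sumr_const -[leLHS]mulr_natl; refine (le_trans _ (compB A0 rA)).
rewrite ler_wpM2r//.
rewrite ler_nat; apply: leq_trans (card_differ u A).
by apply: subset_leq_card; apply/fintype.subsetP => u'; rewrite !inE.
Qed.

Lemma exists_bm_code : exists X : nat -> label kk -> R,
  (err_prob (bm_code h sp delta P m nb X n M0) h <=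
    (nb%:R * (32 * B1 ^+ m + 32 * T + 4 * B3 ^+ m))%:E)%E.
Proof.
have [|X HX] := @exists_random_codebook
    (fun p => @weight R kk nb M p.1 * (ev_valid p.1 p.2)%:R) .
  by move=> p; rewrite mulr_ge0// weight_ge0.
exists X; apply: le_trans (@err_prob_le _ _ _ _ _ _ _ _ _ _ _ _ M0 s0 s1 tau0 mn MK M1 X) _.
rewrite lee_fin; apply: le_trans HX _.
rewrite -(pair_bigA _ (fun u e => @weight R kk nb M u * (ev_valid u e)%:R * kind_B (ev_kind h sp u e) ^+ m))/=.
rewrite -(@sum_weight R kk nb M M0) mulr_suml; apply: ler_sum => u _.
under eq_bigr do rewrite -mulrA.
by rewrite -mulr_sumr ler_wpM2l ?weight_ge0// sum_events.
Qed.

End Existence.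

(** * Achievable rates *)

Section Asymptotics.
Context {R : realType}.

Lemma finite_slack (I : finType) (Q : pred I) (f g : I -> R) :
  (forall i, Q i -> f i < g i) -> exists2 e : R, 0 < e & forall i, Q i -> f i + e <= g i.
Proof.
move=> fg; exists (\big[Num.min/1]_(i | Q i) (g i - f i)).
  by apply: lt_bigmin => // i Qi; rewrite subr_gt0 fg.
by move=> i Qi; rewrite addrC -lerBrDr; exact: bigmin_le_cond.
Qed.

Lemma pow2E (x : R) : 2 `^ x = expR (x * ln 2).
Proof. by rewrite /powR (gt_eqF (_ : 0 < 2))//. Qed.

Lemma msz_gt0 n (r : R) : (0 < msz n r)%N.
Proof. by rewrite /msz absz_gt0 gt_eqF// Num.Theory.ceil_gt0 powR_gt0. Qed.

Lemma msz0 n : msz n (0 : R) = 1%N.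
Proof. by rewrite /msz mulr0 powRr0 (_ : 1 = 1%:~R)// intrKceil. Qed.

Lemma le_msz n (r : R) k : 2 `^ (n%:R * r) <= k%:R -> (msz n r <= k)%N.
Proof.
move=> le; rewrite /msz -lez_nat gez0_abs; last first.
  by rewrite ltW// Num.Theory.ceil_gt0 powR_gt0.
by rewrite Num.Theory.ceil_le_int.
Qed.

Lemma Msz_gt0 n (rt : 'I_3 -> 'I_3 -> R) p : (0 < Msz n rt p)%N.
Proof. by rewrite /Msz; case: ifP => // _; exact: msz_gt0. Qed.

Definition cyclic_rate (r : 'I_3 -> R) (j k : 'I_3) : R :=
  if k == ordS j then r j else 0.

Lemma ordS3_neq (j : 'I_3) : j != ordS j.
Proof. by case: j => [[|[|[|]]]]. Qed.

Lemma Msz_cyclic_le1 n r (j k : 'I_3) : k != ordS j -> (Msz n (cyclic_rate r) (j, k) <= 1)%N.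
Proof.
by move=> /negbTE jk; rewrite /Msz /cyclic_rate /= jk; case: ifP => // _; rewrite msz0.
Qed.

Lemma truncS_le (x : R) : 1 <= x -> (Num.trunc x).+1%:R <= 2 * x.
Proof.
move=> x1; have x0 : 0 <= x by apply: le_trans x1.
by rewrite -natr1 mulr_natl mulr2n lerD// truncn_le.
Qed.

Section fixed_length.
Variables (h : 'I_3 -> R) (P : R) (rho : 'I_3 -> R) (eps : R).
Hypothesis P0 : 0 < P.
Hypothesis rho0 : forall j, 0 <= rho j.
Hypothesis eps0 : 0 < eps.
Hypothesis slack : forall (r : option 'I_3) (A : {set 'I_3}), A != finset.set0 ->
  (if r is Some j then j \notin A else true) ->
  \sum_(a in A) rho a + eps <= ln (1 + P * gain h r A) / 2.

(** Budget for the slack eps: the power back-off costs eps/4, the extra block at most delta,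
    threshold and strictness 2 delta; what is left, 3 eps/8, exceeds delta. *)
Let delta := eps / 8.
Let P' := P * expR (- (eps / 2)).
Let tot := \sum_a rho a.

Let delta0 : 0 < delta. Proof. by rewrite divr_gt0. Qed.
Let P'0 : 0 < P'. Proof. by rewrite mulr_gt0// expR_gt0. Qed.
Let P'P : P' < P.
Proof. by rewrite /P' gtr_pMr// -[ltRHS]expR0 ltr_expR oppr_lt0 divr_gt0. Qed.

(** Follows from 1 + P' g >= exp(-eps/2) (1 + P g). *)
Let ln_outvar r A : ln (1 + P * gain h r A) - eps / 2 <= ln (outvar h (Num.sqrt P') r A).
Proof.
have g0 := gain_ge0 h r A.
have Pg : 0 < 1 + P * gain h r A by rewrite ltr_pwDl// mulr_ge0// ltW.
have E : 0 < expR (- (eps / 2)) by exact: expR_gt0.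
rewrite -[X in _ + X]expRK -lnM ?posrE// ler_ln ?posrE ?mulr_gt0//; last first.
  by apply: lt_le_trans (outvar_ge1 _ _ _ _).
rewrite /outvar sqr_sqrtr ?(ltW P'0)// /P' mulrDl mul1r lerD//.
  by rewrite -[leRHS]expR0 ler_expR oppr_le0 ltW// divr_gt0.
by rewrite mulrAC.
Qed.

Variable nb : nat.
Hypothesis nb0 : (0 < nb)%N.
Hypothesis nb_tot : tot <= nb%:R * delta.

(** Only nb of the nb + 1 blocks carry fresh digits, so the rate inside a block is larger. *)
Let rate a := rho a * (nb.+1%:R / nb%:R).

Let sum_rate (A : {set 'I_3}) : \sum_(a in A) rate a <= \sum_(a in A) rho a + delta.
Proof.
have nbR : (0 : R) < nb%:R by rewrite ltr0n.
have le_tot : \sum_(a in A) rho a <= tot.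
  rewrite /tot [leRHS](bigID (mem A))/= lerDl; exact: sumr_ge0.
rewrite /rate -mulr_suml -natr1 mulrDl mulfV ?gt_eqF// mulrDr mulr1 lerD2l.
by rewrite div1r ler_pdivrMr// mulrC; exact: le_trans nb_tot.
Qed.

(** The factor 8 bounds the rounding loss, 2 per user; exp(tot + delta) pays for the one extra
    letter in m + 1, which comes from rounding n / (nb + 1) down. *)
Lemma competitor_bound r (A : {set 'I_3}) (m : nat) (kk : 'I_3 -> nat) :
  A != finset.set0 -> (if r is Some j then j \notin A else true) ->
  (forall a, (kk a).+1%:R <= 2 * expR (m.+1%:R * rate a)) ->
  (\prod_(a in A) (kk a).+1)%:R *
    ((Num.sqrt (outvar h (Num.sqrt P') r A))^-1 * expR (2 * delta)) ^+ m <=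
  8 * expR (tot + delta) * expR (- delta) ^+ m.
Proof.
move=> A0 rA Hk; set V := outvar _ _ _ _.
have V0 : 0 < V by apply: lt_le_trans (outvar_ge1 _ _ _ _).
have VE : (Num.sqrt V)^-1 = expR (- (ln V / 2)).
  rewrite expRN; congr (_^-1).
  have VV : V = expR (ln V / 2) ^+ 2 by rewrite -expRM_natl mulrC divfK// lnK.
  by rewrite {1}VV sqrtr_sqr ger0_norm ?expR_ge0.
have cards : \prod_(a in A) (2 : R) <= 8.
  rewrite prodr_const -[leRHS](_ : 2 ^+ 3 = _); last by rewrite -natrX.
  by rewrite ler_eXn2l ?ltr1n//; apply: leq_trans (max_card _) _; rewrite card_ord.
have K : (\prod_(a in A) (kk a).+1)%:R <= 8 * expR (m.+1%:R * \sum_(a in A) rate a).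
  rewrite natr_prod; apply: (@le_trans _ _ (\prod_(a in A) (2 * expR (m.+1%:R * rate a)))).
    by apply: ler_prod => a _; rewrite ler0n Hk.
  by rewrite big_split/= -expR_sum -mulr_sumr ler_wpM2r// expR_ge0.
apply: (@le_trans _ _ (8 * expR (m.+1%:R * \sum_(a in A) rate a) *
    expR (m%:R * (2 * delta - ln V / 2)))).
  rewrite ler_pM// ?exprn_ge0// ?mulr_ge0 ?expR_ge0// ?invr_ge0 ?sqrtr_ge0//.
  by rewrite VE -expRD -expRM_natl addrC.
rewrite -!mulrA ler_wpM2l// -[X in _ <= _ * X]expRM_natl -!expRD ler_expR.
have S := sum_rate A; have SL := slack A0 rA; have L := ln_outvar r A.
have le_tot : \sum_(a in A) rho a <= tot.
  rewrite /tot [leRHS](bigID (mem A))/= lerDl; exact: sumr_ge0.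
have L' : \sum_(a in A) rate a + 2 * delta - ln V / 2 <= - delta.
  have e0 := eps0; rewrite -/V in L; move: S; rewrite /delta; lra.
have {}L' := ler_wpM2l (ler0n R m) L'.
rewrite -natr1 mulrDl mul1r.
move: L' S le_tot; rewrite !mulrDr !mulrN; lra.
Qed.

End fixed_length.
End Asymptotics.

Section Achievability.
Context {R : realType}.
Variables (h : 'I_3 -> R) (P : R) (r : 'I_3 -> R).
Hypothesis P0 : 0 < P.
Hypothesis r0 : forall j, 0 <= r j.

Let rho a : R := r a * ln 2.

Let rho0 a : 0 <= rho a.
Proof. by rewrite mulr_ge0// ln_ge0// ler1n. Qed.

Lemma block_code_exists (eps s tau B1 B3 : R) (nb n : nat) :
  let delta := eps / 8 in let P' := P * expR (- (eps / 2)) in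
  let m := (n %/ nb.+1)%N in
  0 < eps ->
  (forall (q : option 'I_3) (A : {set 'I_3}), A != finset.set0 ->
    (if q is Some j then j \notin A else true) ->
    \sum_(a in A) rho a + eps <= ln (1 + P * gain h q A) / 2) ->
  (0 < nb)%N -> \sum_a rho a <= nb%:R * delta ->
  0 < s -> s < 1 -> (Num.sqrt (1 - s ^+ 2))^-1 * expR (- s * delta) < B1 ->
  0 < tau -> 0 < 1 - P' * (2 * tau) ->
  expR (- tau * P) * (Num.sqrt (1 - P' * (2 * tau)))^-1 < B3 ->
  exists c : Defs.code n (Msz n (cyclic_rate r)),
    [/\ code_measurable c, power_ok c h P &
      (err_prob c h <= (nb%:R * (32 * B1 ^+ m +
         32 * (8 * expR (\sum_a rho a + delta) * expR (- delta) ^+ m) + 4 * B3 ^+ m))%:E)%E].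
Proof.
move=> delta P' m eps0 slack nb0 nb_tot s0 s1 failB tau0 pow0 powB.
have nbR : (0 : R) < nb%:R by rewrite ltr0n.
have P'0 : 0 < P' by rewrite mulr_gt0// expR_gt0.
have d0 : 0 < delta by rewrite divr_gt0.
(* The real base in which nb digits exhaust the messages of user [a]; it is rounded up below. *)
pose x a : R := 2 `^ (n%:R * r a / nb%:R).
have xE a : x a = expR (n%:R * rho a / nb%:R) by rewrite /x pow2E /rho; congr expR; ring.
have x1 a : 1 <= x a.
  by rewrite xE -[leLHS]expR0 ler_expR divr_ge0 ?(ltW nbR)// mulr_ge0.
pose kk a := Num.trunc (x a).
have mn : (m * nb.+1 <= n)%N by exact: leq_trunc_div.
have MK j : (Msz n (cyclic_rate r) (j, ordS j) <= (kk j).+1 ^ nb)%N.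
  rewrite /Msz /cyclic_rate /= (negbTE (ordS3_neq j)) eqxx; apply: le_msz.
  have -> : 2 `^ (n%:R * r j) = x j ^+ nb.
    rewrite xE -expRM_natl pow2E /rho; congr expR.
    by field; rewrite gt_eqF.
  rewrite natrX lerXn2r ?nnegrE//; first by apply: le_trans (x1 j).
  exact/ltW/truncnS_gt.
have M1 (j k : 'I_3) : k != ordS j -> (Msz n (cyclic_rate r) (j, k) <= 1)%N.
  exact: Msz_cyclic_le1.
have kkE a : (kk a).+1%:R <= 2 * expR (m.+1%:R * (rho a * (nb.+1%:R / nb%:R))).
  apply: le_trans (truncS_le (x1 a)) _; rewrite ler_wpM2l// xE ler_expR.
  have -> : m.+1%:R * (rho a * (nb.+1%:R / nb%:R)) = m.+1%:R * nb.+1%:R * rho a / nb%:R by ring.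
  rewrite ler_wpM2r ?invr_ge0 ?(ltW nbR)// ler_wpM2r// -natrM ler_nat ltnW//.
  exact: ltn_ceil.
have sp2 : Num.sqrt P' ^+ 2 = P' by rewrite sqr_sqrtr ?ltW.
have [X HX] := @exists_bm_code R kk h (Num.sqrt P') s delta tau P m nb n
  (Msz n (cyclic_rate r)) (fun p => Msz_gt0 n (cyclic_rate r) p) B1 B3
  (8 * expR (\sum_a rho a + delta) * expR (- delta) ^+ m) s0 s1 tau0 d0 mn MK M1 failB
  (etrans (congr1 (fun y => 0 < 1 - y * (2 * tau)) sp2) pow0)
  (etrans (congr1 (fun y => expR (- tau * P) * (Num.sqrt (1 - y * (2 * tau)))^-1 < B3) sp2) powB)
  (mulr_ge0 (mulr_ge0 (ler0n R 8) (expR_ge0 _)) (exprn_ge0 _ (expR_ge0 _)))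
  (fun q A A0 qA => competitor_bound P0 rho0 eps0 slack nb0 nb_tot A0 qA kkE).
exists (bm_code h (Num.sqrt P') delta P m nb X n (fun p => Msz_gt0 n (cyclic_rate r) p)).
split; [exact: bm_code_measurable| |exact: HX].
by apply: bm_code_power; [exact: ltW|exact: mn].
Qed.

Lemma achievable_cyclic :
  (forall (q : option 'I_3) (A : {set 'I_3}), A != finset.set0 ->
    (if q is Some j then j \notin A else true) ->
    \sum_(a in A) rho a < ln (1 + P * gain h q A) / 2) ->
  achievable h P (cyclic_rate r).
Proof.
move=> strict; split=> [j k _|].
  by rewrite /cyclic_rate; case: ifP.
have [|eps eps0 slack] := @finite_slack R (option 'I_3 * {set 'I_3})%type
  (fun p => (p.2 != finset.set0) && (if p.1 is Some j then j \notin p.2 else true))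
  (fun p => \sum_(a in p.2) rho a) (fun p => ln (1 + P * gain h p.1 p.2) / 2).
  by move=> [q A] /andP[A0 qA]; exact: strict.
have {}slack (q : option 'I_3) (A : {set 'I_3}) : A != finset.set0 ->
    (if q is Some j then j \notin A else true) ->
    \sum_(a in A) rho a + eps <= ln (1 + P * gain h q A) / 2.
  by move=> A0 qA; apply: (slack (q, A)); rewrite A0.
pose delta := eps / 8; pose P' := P * expR (- (eps / 2)).
have d0 : 0 < delta by rewrite divr_gt0.
have P'0 : 0 < P' by rewrite mulr_gt0// expR_gt0.
have P'P : P' < P.
  by rewrite /P' gtr_pMr// -[ltRHS]expR0 ltr_expR oppr_lt0 divr_gt0.
have [s [B1 [s0 s1 B1lt failB]]] := exists_fail_parameter d0.
have [tau [B3 [tau0 pow0 B3lt powB]]] := exists_power_parameter P'0 P'P.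
(* Large enough for the rate loss tot / nb to be at most delta, and independent of n. *)
pose nb := (Num.trunc ((\sum_a rho a) / delta)).+1.
have nb_tot : \sum_a rho a <= nb%:R * delta.
  by rewrite -ler_pdivrMr// ltW// truncnS_gt.
have H n := block_code_exists n eps0 slack (ltn0Sn _ : 0 < nb)%N nb_tot s0 s1 failB tau0 pow0 powB.
exists (fun n => projT1 (cid (H n))); split=> [n|]; first by case: cid => c [].
split=> [n|]; first by case: cid => c [].
set T := (8 * expR (\sum_a rho a + delta)).
pose g m : R := nb%:R * (32 * B1 ^+ m + 32 * (T * expR (- delta) ^+ m) + 4 * B3 ^+ m).
apply: (@squeeze_cvge _ _ _ _ (fun=> 0%E) _ (fun n => (g (n %/ nb.+1)%N)%:E)).
- apply: nearW => n; apply/andP; split; last by case: cid => c [].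
  rewrite /err_prob /Eavg mule_ge0// ?lee_fin ?invr_ge0//.
  by apply: sume_ge0 => w _; apply: Gexp_ge0 => z; rewrite lee_fin.
- exact: cvg_cst.
have B10 : `|B1| < 1.
  rewrite ger0_norm//; apply: ltW; apply: le_lt_trans failB.
  by rewrite mulr_ge0 ?expR_ge0// invr_ge0 sqrtr_ge0.
have B30 : `|B3| < 1.
  rewrite ger0_norm//; apply: ltW; apply: le_lt_trans powB.
  by rewrite mulr_ge0 ?expR_ge0// invr_ge0 sqrtr_ge0.
have Bd : `|expR (- delta)| < 1.
  by rewrite ger0_norm ?expR_ge0// -[ltRHS]expR0 ltr_expR oppr_lt0.
apply: cvg_EFin; first exact: nearW.
have gE : g m @[m --> \oo] --> (0 : R).
  rewrite [X in _ --> X](_ : _ = nb%:R * (32 * 0 + 32 * (T * 0) + 4 * 0)); last by ring.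
  apply: cvgMr; apply: cvgD; first apply: cvgD.
  - by apply: cvgMr; exact: cvg_expr.
  - by apply: cvgMr; apply: cvgMr; exact: cvg_expr.
  - by apply: cvgMr; exact: cvg_expr.
exact: (cvg_comp _ _ (@cvg_divnr nb.+1 isT) gE).
Qed.

End Achievability.

(** * Choice of the three rates and the lower bound *)

Section RateSplitting.
Context {R : realType}.

(** Below D one message suffices; between D and B two equal rates s/2 do; above B the constraints on
    the pairs (1,3) and (1,2) are nearly tight. *)
Lemma exists_rates (A B D s : R) : D <= B -> B <= A -> 0 <= s ->
  2 * s < A + B + D -> s < 2 * D ->
  exists r1 r2 r3 : R, [/\ 0 <= r1, 0 <= r2, 0 <= r3, r1 + r2 + r3 = s &
    [/\ r2 + r3 < A, r1 + r3 < B, r1 + r2 < D & r3 < D]].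
Proof.
move=> DB BA s0 s1 s2; have [sD|Ds] := ltP s D.
  by exists s, 0, 0; do ![split] => //; lra.
have [sB|Bs] := ltP s B.
  exists (D - (2 * D - s) / 2), 0, (s - D + (2 * D - s) / 2).
  by do ![split] => //; lra.
(* The rates solve r1 + r3 = B - e, r1 + r2 = D - e and r1 + r2 + r3 = s. The first bound on e gives
   0 <= r1 and r3 < D, the second r2 + r3 < A. *)
pose e := Num.min ((2 * D - s) / 2) ((A + B + D - 2 * s) / 4).
have e1 : e <= (2 * D - s) / 2 by rewrite /e ge_min lexx.
have e2 : e <= (A + B + D - 2 * s) / 4 by rewrite /e ge_min lexx orbT.
have e0 : 0 < e by rewrite /e lt_min; apply/andP; split; lra.
exists (D + B - s - 2 * e), (s - B + e), (s - D + e).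
by do ![split] => //; lra.
Qed.

Let ln2 : 0 < ln (2 : R).
Proof. by rewrite ln_gt0// ltr1n. Qed.

Lemma le_Ccap (x y : R) : 0 <= x -> x <= y -> Ccap x <= Ccap y.
Proof.
move=> x0 xy; rewrite /Ccap ler_pM2r ?invr_gt0 ?mulr_gt0//.
by rewrite ler_ln ?posrE ?lerD2l//; lra.
Qed.

Lemma lt_Ccap (x y : R) : x < Ccap y -> x * ln 2 < ln (1 + y) / 2.
Proof.
rewrite /Ccap ltr_pdivlMr ?mulr_gt0// => H; rewrite ltr_pdivlMr//.
by move: H; rewrite mulrA mulrAC.
Qed.

Lemma big_users (f : 'I_3 -> R) (A : {set 'I_3}) : \sum_(a in A) f a =
  (if u1 \in A then f u1 else 0) + (if u2 \in A then f u2 else 0) +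
  (if u3 \in A then f u3 else 0).
Proof.
have -> : u1 = ord0 by apply: val_inj; rewrite /= inordK.
have -> : u2 = lift ord0 ord0 by apply: val_inj; rewrite /= inordK.
have -> : u3 = lift ord0 (lift ord0 ord0) by apply: val_inj; rewrite /= inordK.
by rewrite big_mkcond /= !big_ord_recl big_ord0 /= addr0 addrA.
Qed.

Lemma sum_cyclic_rate (r : 'I_3 -> R) :
  \sum_(j < 3) \sum_(k < 3 | k != j) cyclic_rate r j k = \sum_j r j.
Proof.
apply: eq_bigr => j _; rewrite (bigD1 (ordS j)) 1?eq_sym ?ordS3_neq//=.
rewrite {1}/cyclic_rate eqxx big1 ?addr0// => k /andP[_ /negbTE kj].
by rewrite /cyclic_rate kj.
Qed.

(** Serves the case of a nonpositive target. With m = nb = 0 nothing is sent, all message sets are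
    singletons, and [bm_code_correct] holds vacuously. *)
Lemma achievable0 (h : 'I_3 -> R) (P : R) : 0 <= P -> achievable h P (cyclic_rate (fun=> 0)).
Proof.
move=> P0; split=> [j k _|]; first by rewrite /cyclic_rate; case: ifP.
pose X : nat -> label (fun=> 0%N) -> R := fun _ _ => 0.
have le1 n j k : (Msz n (cyclic_rate (fun=> (0%R : R))) (j, k) <= 1)%N.
  by rewrite /Msz /cyclic_rate /= !if_same msz0; case: ifP.
exists (fun n => bm_code h 0 0 P 0 0 X n (fun p => Msz_gt0 n (cyclic_rate (fun=> 0)) p)).
split=> [n|]; first exact: bm_code_measurable.
split=> [n|]; first exact: bm_code_power.
apply: (@cvg_trans _ (cst 0%E @ \oo)); last exact: cvg_cst.
apply: near_eq_cvg; apply: nearW => n.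
rewrite /err_prob /Eavg big1 ?mule0// => w _.
rewrite -[RHS](Gexp_cst (4 * n)); congr (Gexp _ _); apply/funext => z.
by rewrite (@bm_code_correct _ _ h 0 1 0 1 P 0 0).
Qed.

End RateSplitting.

Theorem theorem3 (R : realType) (h : 'I_3 -> R) (P : R) :
  h u2 ^+ 2 <= h u1 ^+ 2 -> h u3 ^+ 2 <= h u2 ^+ 2 -> 0 < P ->
  ((Clow1 h P)%:E <= sum_capacity h P)%E.
Proof.
set a := h u1 ^+ 2; set b := h u2 ^+ 2; set d := h u3 ^+ 2 => ba db P0.
have d0 : 0 <= d by exact: sqr_ge0.
(* Giving up [e] makes all rate constraints strict, as [achievable_cyclic] requires. *)
apply/lee_subgt0Pr => e e0; rewrite -EFinB; set s := Clow1 h P - e.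
have [sle0|s0] := leP s 0.
  apply: (@le_trans _ _ 0%E); first by rewrite lee_fin.
  apply: ereal_sup_ubound; exists (cyclic_rate (fun=> 0)); first exact/achievable0/ltW.
  by rewrite sum_cyclic_rate big1.
set A := Ccap (Num.min a (b + d) * P); set B := Ccap (b * P); set D := Ccap (d * P).
have dP : 0 <= d * P by rewrite mulr_ge0// ltW.
have mono x y : 0 <= x -> x <= y -> Ccap (x * P) <= Ccap (y * P).
  by move=> x0 xy; rewrite le_Ccap ?mulr_ge0 ?(ltW P0)// ler_wpM2r// ltW.
have b0 : 0 <= b by exact: sqr_ge0.
have a0 : 0 <= a by exact: sqr_ge0.
have m0 : 0 <= Num.min a (b + d) by rewrite le_min a0 addr_ge0.
have DB : D <= B by exact: mono.
have BA : B <= A by apply: mono => //; rewrite le_min ba lerDl.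
have sC : s < Clow1 h P by rewrite /s ltrBlDr ltrDl.
move: sC; rewrite /Clow1 -/a -/b -/d -/A -/B -/D !lt_min => /andP[/andP[sABD sT] sD].
have [|r1 [r2 [r3 [r10 r20 r30 rs [rA rB rD r3D]]]]] := exists_rates DB BA (ltW s0) _ sD.
  by lra.
pose r (j : 'I_3) := if j == u1 then r1 else if j == u2 then r2 else r3.
have u12 : (u2 == u1) = false by rewrite -val_eqE /= !inordK.
have u13 : (u3 == u1) = false by rewrite -val_eqE /= !inordK.
have u23 : (u3 == u2) = false by rewrite -val_eqE /= !inordK.
have ru1 : r u1 = r1 by rewrite /r eqxx.
have ru2 : r u2 = r2 by rewrite /r u12 eqxx.
have ru3 : r u3 = r3 by rewrite /r u13 u23.
apply: ereal_sup_ubound; exists (cyclic_rate r); last first.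
  rewrite sum_cyclic_rate; congr EFin.
  have := big_users r finset.setT; rewrite !finset.in_setT ru1 ru2 ru3 rs => <-.
  by apply: eq_bigl => j; rewrite finset.in_setT.
apply: achievable_cyclic => //; first by move=> j; rewrite /r; case: ifP => // _; case: ifP.
move=> q S S0 qS; rewrite -mulr_suml; apply: lt_Ccap; rewrite mulrC.
have Ssome : [|| u1 \in S, u2 \in S | u3 \in S].
  apply: contraR S0; rewrite !negb_or => /and3P[/negbTE n1 /negbTE n2 /negbTE n3].
  have := big_users (fun=> (1 : R)) S; rewrite n1 n2 n3 !addr0 sumr_const => /eqP.
  by rewrite pnatr_eq0 cards_eq0.
rewrite big_users ru1 ru2 ru3.
have ltm x y z : 0 <= y -> y <= z -> x < Ccap (y * P) -> x < Ccap (z * P).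
  by move=> y0 yz xy; apply: lt_le_trans xy _; exact: mono.
have minb : Num.min a (b + d) <= b + d by rewrite ge_min lexx orbT.
have mina : Num.min a (b + d) <= a by rewrite ge_min lexx.
(* At the relay every nonempty index set gives a constraint; those not among the chosen ones follow
   because d is the smallest squared gain and b <= a. *)
case: q qS => [j|_] /=; last first.
  rewrite big_users -/a -/b -/d; move: Ssome.
  case: (u1 \in S); case: (u2 \in S); case: (u3 \in S) => //= _; rewrite ?addr0 ?add0r.
  - by rewrite rs.
  - by apply: (ltm _ d) => //; lra.
  - by apply: (ltm _ b) => //; lra.
  - by apply: (ltm _ d) => //; rewrite -/D; lra.
  - exact: (ltm _ (Num.min a (b + d))).
  - by apply: (ltm _ d) => //; rewrite -/D; lra.
  - by rewrite -/D.
have : [|| j == u1, j == u2 | j == u3].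
  rewrite -!val_eqE /= !inordK//; by case: j => [[|[|[|]]]].
(* A user knows its own index, so its worst case is the pair of the other two. *)
case/or3P => /eqP -> /negbTE ->; rewrite ?add0r ?addr0.
- by apply: (ltm _ (Num.min a (b + d))) => //; rewrite -/A; case: ifP => _; case: ifP => _; lra.
- by rewrite -/b -/B; case: ifP => _; case: ifP => _; lra.
- by rewrite -/d -/D; case: ifP => _; case: ifP => _; lra.
Qed.
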